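(* Let $r\ge1$. Assume that $u$ is the solution of $$-(\alpha u')'+\beta u'+\gamma u=f\ \text{ in }\Omega,\qquad u(a)=u(b)=0,$$ and that $u_{\mathcal P}\in U^r_{\mathcal P}$ is the solution of the finite volume scheme $a_{\mathcal P}(u_{\mathcal P},w)=\int_a^b fw\,dx$ for all $w\in V_{\mathcal P'}$. Then the finite volume bilinear form $a_{\mathcal P}(\cdot,\cdot)$ is (i) variationally exact: $a_{\mathcal P}(u,w)=\int_a^b f w\,dx$ for all $w\in V_{\mathcal P'}$; (ii) bounded: for all $v\in H^1_0(\Omega)\cap H^2_{\mathcal P}(\Omega)$ and $w\in V_{\mathcal P'}$, $$|a_{\mathcal P}(v,w)|\le M\,\|v\|_{\mathcal P}\,\|w\|_{\mathcal P'},$$ where the constant $M>0$ depends only on $r,\alpha_0,\kappa$ and $\Omega$. (iii) Consequently, for $h$ sufficiently small, $$\|u-u_{\mathcal P}\|_{\mathcal P}\le\frac{M}{c_2}\inf_{v\in U^r_{\mathcal P}}\|u-v\|_{\mathcal P},$$ where $c_2>0$, depending only on $r,\alpha_0,\kappa$ and $\Omega$, is the constant in the inf-sup condition (valid for $h$ sufficiently small) $$\inf_{v\in U^r_{\mathcal P}}\ \sup_{w\in V_{\mathcal P'}}\frac{a_{\mathcal P}(v,w)}{\|v\|_{\mathcal P}\|w\|_{\mathcal P'}}\ge c_2 .$$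
   Context: Coefficients. $\Omega=(a,b)$ is an interval; $\alpha,\beta,\gamma\in L^\infty(\bar\Omega)$, $\alpha\ge\alpha_0>0$, $\gamma-\tfrac12\beta'\ge\kappa>0$; $f$ is a real-valued function on $\bar\Omega$. Primal mesh. For $a=x_0<\dots<x_N=b$ put $\tau_i=[x_{i-1},x_i]$, $h_i=x_i-x_{i-1}$, $h=\max_ih_i$, $\mathcal P=\{\tau_i\}_{i=1}^N$. The trial space is $U^r_{\mathcal P}=\{v\in C(\Omega): v|_{\tau_i}$ is a polynomial of degree $\le r$ for each $i$, $v(a)=v(b)=0\}$. The broken space is $H^2_{\mathcal P}(\Omega)=\{v\in C(\Omega): v|_{\tau_i}\in H^2(\tau_i)\ \forall i\}$ with norm $$\|v\|_{\mathcal P}^2=\sum_{i=1}^N\big(\|v\|_{L^2(\tau_i)}^2+\|v'\|_{L^2(\tau_i)}^2+h_i^2\|v''\|_{L^2(\tau_i)}^2\big).$$ Dual mesh. Let $G_1<\dots<G_r$ be the zeros in $[-1,1]$ of the Legendre polynomial of degree $r$; $g_{i,j}=\tfrac12(x_i+x_{i-1}+h_iG_j)$ for $1\le i\le N$, $1\le j\le r$, and $g_{i,r+1}=g_{i+1,1}$ for $1\le i\le N-1$. Put $r_i=r$ for $i\le N-1$ and $r_N=r-1$. The test space $V_{\mathcal P'}$ consists of $w=\sum_{i=1}^N\sum_{j=1}^{r_i}w_{i,j}\chi_{[g_{i,j},g_{i,j+1}]}$, $w_{i,j}\in\mathbb R$, where $\chi$ denotes a characteristic function. With $w_{1,0}=0$,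 $w_{N,r}=0$, $w_{i,0}=w_{i-1,r}$ ($2\le i\le N$), the jumps are $[w_{i,j}]=w_{i,j}-w_{i,j-1}$ for $1\le i\le N$, $1\le j\le r$, and $$\|w\|_{\mathcal P'}^2=\sum_{i=1}^N\sum_{j=1}^r h_i^{-1}[w_{i,j}]^2+\sum_{i=1}^N\sum_{j=1}^{r_i}h_iw_{i,j}^2 .$$ Bilinear form. $$a_{\mathcal P}(v,w)=\sum_{i=1}^N\sum_{j=1}^r[w_{i,j}]\,\alpha(g_{i,j})v'(g_{i,j})+\sum_{i=1}^N\sum_{j=1}^{r_i}w_{i,j}\int_{g_{i,j}}^{g_{i,j+1}}\big(\beta v'+\gamma v\big)\,dx .$$
   Formalization: M also depends on a common sup bound of α, β, γ (as stated it fails for α=K→∞); α is bounded pointwise, with flux αu' absolutely continuous and matched where u' exists; β absolutely continuous, f integrable, u' exists at Gauss points in (i), u in H²_P in (iii). *)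

(* Defs.v *)
From HB Require Import structures.
From mathcomp Require Import all_boot all_order all_algebra.
From mathcomp Require Import all_classical all_reals all_analysis.
Import Order.TTheory GRing.Theory Num.Theory.
Import numFieldNormedType.Exports.

Set Implicit Arguments.
Unset Strict Implicit.
Unset Printing Implicit Defensive.

Local Open Scope classical_set_scope.
Local Open Scope ring_scope.

(* Functions on a closed interval are represented by total functions R -> R of
   which only the values on that interval matter.  Meshes, Gauss points and
   test-function coefficients are nat-indexed from 1, as in the mathematical
   notation; their values outside the stated index ranges are irrelevant. *)

Section Spaces.
Context {R : realType}.
Local Notation mu := (@lebesgue_measure R).
Implicit Types (c d : R) (v g : R -> R).

(* One-dimensional weak derivative of the absolutely continuous representative:
   v is absolutely continuous on [c, d] and v' = g almost everywhere.  Point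
   values of v' enter the scheme, so elements of Sobolev spaces are taken to be
   their absolutely continuous representatives. *)
Definition weak_deriv c d v g : Prop :=
  mu.-integrable `[c, d] (EFin \o g) /\
  forall y, c <= y <= d -> v y = v c + \int[mu]_(t in `[c, y]) g t.

Definition L2 c d g : Prop :=
  measurable_fun `[c, d] g /\
  (\int[mu]_(t in `[c, d]) ((g t) ^+ 2)%:E < +oo)%E.

Definition H1 c d v : Prop := exists g, L2 c d g /\ weak_deriv c d v g.

(* The function g is then the continuous representative of v', so that v is C^1
   on [c, d] and g = v' everywhere on ]c, d[. *)
Definition H2 c d v : Prop := exists g, H1 c d g /\ weak_deriv c d v g.

Definition H10 c d v : Prop := [/\ H1 c d v, v c = 0 & v d = 0].

Definition ess_bounded c d (L : R) g : Prop :=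
  measurable_fun `[c, d] g /\
  {ae mu, forall y, c <= y <= d -> `|g y| <= L}.

End Spaces.

Section Problem.
Context {R : realType}.
Local Notation mu := (@lebesgue_measure R).
Variables (a b : R) (alpha beta gamma : R -> R).

(* The scheme samples alpha at individual points, so its bounds are imposed at
   every point of [a, b] and not only almost everywhere. *)
Definition coefficients (alpha0 kappa L : R) : Prop :=
  [/\ [/\ ess_bounded a b L alpha, ess_bounded a b L beta
        & ess_bounded a b L gamma],
      forall y, a <= y <= b -> alpha0 <= alpha y <= L
    & exists dbeta, weak_deriv a b beta dbeta /\
        {ae mu, forall y, a <= y <= b -> kappa <= gamma y - dbeta y / 2} ].

(* - (alpha u')' + beta u' + gamma u = f: the flux q is absolutely continuous,
   satisfies q' = beta u' + gamma u - f almost everywhere, and equals alpha u'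
   wherever u is differentiable.  The solution may have kinks where alpha
   jumps. *)
Definition bvp_solution (f u : R -> R) : Prop :=
  H10 a b u /\
  exists q : R -> R,
    (forall y, a < y < b -> derivable u y 1 -> q y = alpha y * derive1 u y) /\
    weak_deriv a b q (fun y => beta y * derive1 u y + gamma y * u y - f y).

End Problem.

Section Legendre.
Context {R : realType}.

(* Rodrigues' formula *)
Definition legendre (n : nat) : {poly R} :=
  (2 ^+ n * n`!%:R)^-1 *: derivn n (('X ^+ 2 - 1) ^+ n).

(* G 1 < ... < G r are the r zeros of the Legendre polynomial of degree r. *)
Definition gauss_points (r : nat) (G : nat -> R) : Prop :=
  (forall j, (1 <= j <= r)%N -> -1 <= G j <= 1 /\ root (legendre r) (G j)) /\
  (forall j k, (1 <= j)%N -> (j < k)%N -> (k <= r)%N -> G j < G k).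

End Legendre.

Section Scheme.
Context {R : realType}.
Local Notation mu := (@lebesgue_measure R).
Variables (r N : nat) (x G : nat -> R).
Implicit Types (v : R -> R) (w : nat -> nat -> R).

Definition mesh (a b : R) : Prop :=
  [/\ (0 < N)%N, x 0%N = a, x N = b & forall i, (i < N)%N -> x i < x i.+1].

Definition hstep (i : nat) : R := x i - x i.-1.

Definition meshsize : R := \big[Order.max/0]_(1 <= i < N.+1) hstep i.

Definition trial_space v : Prop :=
  [/\ {within `[x 0%N, x N], continuous v},
      forall i, (1 <= i <= N)%N -> exists p : {poly R}, (size p <= r.+1)%N /\
        forall y, x i.-1 <= y <= x i -> v y = p.[y],
      v (x 0%N) = 0 & v (x N) = 0].

Definition H2_broken v : Prop :=
  {within `[x 0%N, x N], continuous v} /\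
  forall i, (1 <= i <= N)%N -> H2 (x i.-1) (x i) v.

Definition norm_P v : R :=
  Num.sqrt (\sum_(1 <= i < N.+1)
    (\int[mu]_(t in `[x i.-1, x i]) (v t ^+ 2)
     + \int[mu]_(t in `[x i.-1, x i]) (derive1 v t ^+ 2)
     + hstep i ^+ 2 * \int[mu]_(t in `[x i.-1, x i]) (derive1n 2 v t ^+ 2))).

(* with the convention g_(i, r+1) = g_(i+1, 1) *)
Definition gpt (i j : nat) : R :=
  let pt k l := (x k + x k.-1 + hstep k * G l) / 2 in
  if j == r.+1 then pt i.+1 1%N else pt i j.

Definition rdual (i : nat) : nat := if i == N then r.-1 else r.

(* The element of the test space with coefficients w; the test space is the set
   of all test_fun w, and functionals on it are written in terms of w. *)
Definition test_fun w (y : R) : R :=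
  \sum_(1 <= i < N.+1) \sum_(1 <= j < (rdual i).+1)
    w i j * \1_(`[gpt i j, gpt i j.+1]) y.

(* w extended by w_(1,0) = 0, w_(N,r) = 0 and w_(i,0) = w_(i-1,r) for i >= 2 *)
Definition wext w (i j : nat) : R :=
  if j == 0%N then (if i == 1%N then 0 else w i.-1 r)
  else if (i == N) && (j == r) then 0 else w i j.

Definition jump w (i j : nat) : R := wext w i j - wext w i j.-1.

Definition norm_P' w : R :=
  Num.sqrt (\sum_(1 <= i < N.+1) \sum_(1 <= j < r.+1)
              (hstep i)^-1 * jump w i j ^+ 2
            + \sum_(1 <= i < N.+1) \sum_(1 <= j < (rdual i).+1)
              hstep i * w i j ^+ 2).

Definition a_P (alpha beta gamma : R -> R) v w : R :=
  \sum_(1 <= i < N.+1) \sum_(1 <= j < r.+1)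
    jump w i j * alpha (gpt i j) * derive1 v (gpt i j)
  + \sum_(1 <= i < N.+1) \sum_(1 <= j < (rdual i).+1)
    w i j * \int[mu]_(t in `[gpt i j, gpt i j.+1])
              (beta t * derive1 v t + gamma t * v t).

Definition load (f : R -> R) w : R :=
  \int[mu]_(t in `[x 0%N, x N]) (f t * test_fun w t).

Definition fv_solution (alpha beta gamma f v : R -> R) : Prop :=
  trial_space v /\ forall w, a_P alpha beta gamma v w = load f w.

(* Infimum and supremum range over the v and w for which the quotient makes
   sense; they are taken in the extended reals so that an empty trial set is
   harmless. *)
Definition inf_sup (alpha beta gamma : R -> R) : \bar R :=
  ereal_inf
    [set ereal_sup
           [set (a_P alpha beta gamma v w / (norm_P v * norm_P' w))%:E
              | w in [set w | norm_P' w != 0]]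
       | v in [set v | trial_space v /\ norm_P v != 0]].

End Scheme.

(* Main.v *)
(* Let Phi(y) be the integral of beta v' + gamma v over [a, y].  Summation by
   parts turns the scheme into
     a_P(v, w) = sum_ij [w_ij] (alpha v' - Phi)(g_ij),
   and likewise the load into a sum over jumps of the primitive of f.  Exactness
   is then the identity "flux = constant + Phi - primitive of f", and boundedness
   is Cauchy-Schwarz together with a trace estimate for v' on each element.

   For the inf-sup condition, pair v with the w whose jumps are the
   Gauss-weighted values h_i A_j v'(g_ij).  Exactness of the quadrature makes w
   agree with v at the nodes, the first term dominates alpha0 |v'|^2, and
   sum_ij h_i A_j v' Phi (g_ij) differs from the integral of v' Phi by O(sqrt h)
   |v'|^2.  By parts, minus this integral is the integral of
   (gamma - beta'/2) v^2, which is nonnegative.  All of this needs only the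
   bound |v''| <= C |v'| / h_i on polynomials and gives a constant depending on
   r, alpha0 and b - a alone.  Quasi-optimality follows from the triangle
   inequality; the bound M is taken as M0 + c2 with M0 the Cauchy-Schwarz bound,
   so that M / c2 = 1 + M0 / c2. *)
Require Import Defs.
From HB Require Import structures.
From mathcomp Require Import all_boot all_order all_algebra.
From mathcomp Require Import all_classical all_reals all_analysis.
From mathcomp Require Import measurable_realfun.
From mathcomp Require Import ring lra.
Import Order.TTheory GRing.Theory Num.Theory.
Import numFieldNormedType.Exports.

Set Implicit Arguments.
Unset Strict Implicit.
Unset Printing Implicit Defensive.

Local Open Scope classical_set_scope.
Local Open Scope ring_scope.

(** The coefficients are only bounded, so [Phi] is merely absolutely continuous and the classical
    Gauss remainder, with its high derivatives of the integrand, is out of reach. On each element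
    [Phi] is compared instead with its value at the left node: the rule integrates v' exactly, so
    the constant costs nothing, and only the oscillation of [Phi] remains. The mesh is taken so fine
    that this remainder is absorbed by half of alpha0 |v'|^2. The same exactness makes the test
    function admissible: its jumps add up to v(b) - v(a) = 0, as its zero end values require. A
    second difficulty is that the norms and the form use the total functions [derive1] and
    [derive1n 2], whose values are arbitrary where the derivative does not exist: possibly at mesh
    nodes and, for the second, on a null set. Linearity of the form and the triangle inequality are
    therefore not formal, and integrals are carried over to weak derivatives by equality on open
    intervals or almost everywhere. *)

Lemma ae_imp d (T : measurableType d) (R : realType)
    (mu : {measure set T -> \bar R}) (P Q : T -> Prop) :
  (forall y, P y -> Q y) -> {ae mu, forall y, P y} -> {ae mu, forall y, Q y}.
Proof.
move=> PQ [A [mA A0 PA]]; exists A; split => // y /= nQ; apply: PA => /= Py.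
by apply: nQ; exact: PQ.
Qed.

(** * Almost-everywhere comparison of integrals *)

Section AlmostEverywhere.
Import HBNNSimple.

(* No measurability is assumed, since [derive1n 2 v] is only known to agree almost
   everywhere with a measurable function: the integral of a nonnegative function
   is a supremum over simple functions. *)
Lemma ge0_ae_le_integral d (T : measurableType d) (R : realType)
    (mu : {measure set T -> \bar R}) (D : set T) (f g : T -> \bar R) :
  (forall x, 0 <= f x)%E -> (forall x, 0 <= g x)%E ->
  {ae mu, forall x, D x -> (f x <= g x)%E} ->
  (\int[mu]_(x in D) f x <= \int[mu]_(x in D) g x)%E.
Proof.
move=> f0 g0 [A [mA A0 fgA]].
rewrite !ge0_integralE//; apply: ge_ereal_sup => _ [h hf <-].
(* Cutting [h] off on the exceptional null set keeps its integral and puts it below [g] everywhere,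
   so that it competes in the supremum for [g]. *)
pose h' := mul_nnsfun h (indic_nnsfun R (measurableC mA)).
have h'E x : h' x = h x * (x \in ~` A)%:R by [].
have -> : sintegral mu h = sintegral mu h'.
  have E (k : {nnsfun T >-> R}) : sintegral mu k = (\int[mu]_x (k x)%:E)%E.
    by rewrite integral_nnsfun// patch_setT.
  rewrite !E; apply: ae_eq_integral => //; [exact/measurable_EFinP|exact/measurable_EFinP|].
  exists A; split => // x /= /not_implyP[_]; apply: contra_notP => Ax.
  by rewrite mindicE mem_set ?mulr1.
apply: ereal_sup_ubound; exists h' => // x; rewrite h'E.
have [xA|xA] := boolP (x \in ~` A); last first.
  by rewrite mulr0 /patch; case: ifP.
rewrite mulr1 (le_trans (hf x))// /patch; case: ifPn => // /[!inE] Dx.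
apply: contrapT => k; move: xA => /[!inE]; apply.
by apply: fgA => /= /(_ Dx).
Qed.

End AlmostEverywhere.

(** * Integrals over closed intervals *)

Section Integral.
Context {R : realType}.
Local Notation mu := (@lebesgue_measure R).
Local Notation itg c d f := (mu.-integrable `[c, d] (EFin \o f)).
Local Notation "''I' ( c , d , f )" := (\int[mu]_(t in `[c, d]) f t).
Implicit Types (c d m l : R) (f g k u v : R -> R).

Lemma itg_meas c d f : itg c d f -> measurable_fun `[c, d] f.
Proof. by move=> /(measurable_int mu)/measurable_EFinP. Qed.

Lemma itg_sub c d c' d' f : c <= c' -> d' <= d -> itg c d f -> itg c' d' f.
Proof.
move=> cc dd; apply: integrableS => //.
by apply: subset_itv; rewrite bnd_simp.
Qed.

Lemma itgD c d f g : itg c d f -> itg c d g -> itg c d (fun t => f t + g t).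
Proof. by move=> F G; apply: (integrableD _ F G). Qed.

Lemma itgZ c d l f : itg c d f -> itg c d (fun t => l * f t).
Proof. by move=> F; apply: (integrableZl _ l F). Qed.

Lemma itgB c d f g : itg c d f -> itg c d g -> itg c d (fun t => f t - g t).
Proof. by move=> F G; apply: (integrableB _ F G). Qed.

Lemma itg_norm c d f : itg c d f -> itg c d (fun t => `|f t|).
Proof. by move=> F; apply: (integrable_norm F). Qed.

Lemma itg_cst c d l : itg c d (fun=> l).
Proof.
apply: continuous_compact_integrable; first exact: segment_compact.
by apply: continuous_subspaceT => x; exact: cvg_cst.
Qed.

Lemma itg_le c d f g : measurable_fun `[c, d] f ->
  (forall y, c <= y <= d -> `|f y| <= g y) -> itg c d g -> itg c d f.
Proof.
move=> mf fg; apply: le_integrable => //; first exact/measurable_EFinP.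
move=> y /=; rewrite in_itv/= => /fg h; rewrite lee_fin.
by rewrite (le_trans h)// ler_norm.
Qed.

Lemma int_xx c f : 'I(c, c, f) = 0.
Proof. by rewrite set_itv1 Rintegral_set1. Qed.

Lemma int_cst c d l : c <= d -> 'I(c, d, fun=> l) = l * (d - c).
Proof.
move=> cd; rewrite Rintegral_cst//= lebesgue_measure_itv/= lte_fin.
by case: ltP => //= dc; rewrite [c](@le_anti _ _ c d) ?cd// subrr.
Qed.

Lemma itv_split c m d : c <= m -> m <= d ->
  `[c, d]%classic = `[c, m] `|` `]m, d].
Proof. by move=> cm md; rewrite -itv_bndbnd_setU ?bnd_simp. Qed.

Lemma int_split c m d f : c <= m -> m <= d -> itg c d f ->
  'I(c, d, f) = 'I(c, m, f) + 'I(m, d, f).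
Proof.
move=> cm md F.
have F' : mu.-integrable `]m, d] (EFin \o f).
  apply: (integrableS _ _ _ F) => //; apply: subset_itv; rewrite bnd_simp//.
rewrite -(Rintegral_itv_obnd_cbnd F') (itv_split cm md) Rintegral_setU//.
- by rewrite -itv_split.
- apply/eqP; rewrite -subset0 => y [] /=; rewrite !in_itv/= => /andP[_ ym] /andP[my _].
  by move: (lt_le_trans my ym); rewrite ltxx.
Qed.

Lemma itg_glue c m d f : c <= m -> m <= d ->
  itg c m f -> itg m d f -> itg c d f.
Proof.
move=> cm md /integrableP[mf1 F1] /integrableP[mf2 F2].
have s2 : `]m, d]%classic `<=` `[m, d]%classic.
  by apply: subset_itv; rewrite bnd_simp.
have mf2' := measurable_funS (measurable_itv _) s2 mf2.
have mU : measurable_fun (`[c, m] `|` `]m, d]) (EFin \o f).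
  by apply/measurable_funU.
apply/integrableP; rewrite (itv_split cm md); split => //.
rewrite ge0_integral_setU//; last 2 first.
- exact: measurableT_comp mU.
- apply/eqP; rewrite -subset0 => y [] /=; rewrite !in_itv/= => /andP[_ ym] /andP[my _].
  by move: (lt_le_trans my ym); rewrite ltxx.
rewrite lte_add_pinfty//; apply: le_lt_trans F2; apply: ge0_subset_integral => //.
exact: measurableT_comp.
Qed.

(** End points form a null set. They have to be disregarded because [derive1 v] is controlled only
    inside an element: at a mesh node [v] may have a kink. *)
Lemma itg_oo c d f g : (forall y, c < y < d -> f y = g y) -> itg c d f ->
  itg c d g.
Proof.
move=> fg /[dup] F /integrableP[/measurable_EFinP mf Ff].
have soo : `]c, d[%classic `<=` `[c, d]%classic.
  by apply: subset_itv; rewrite bnd_simp.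
have mfo := measurable_funS (measurable_itv _) soo mf.
have mgo : measurable_fun `]c, d[ g.
  by apply: eq_measurable_fun mfo => y /[!inE]/=; rewrite in_itv/= => /fg.
have mg : measurable_fun `[c, d] g by exact: (@measurable_fun_itv_cc _ _ _ false true).
have mE (h : R -> R) : measurable_fun `]c, d[ h -> measurable_fun `]c, d[ (fun x => `|(EFin \o h) x|%E).
  by move=> mh; apply: measurableT_comp => //; exact/measurable_EFinP.
apply/integrableP; split; first exact/measurable_EFinP.
move: Ff; rewrite !(integral_itv_bndoo true false); [|exact: mE|exact: mE].
apply: le_lt_trans; rewrite le_eqVlt; apply/orP; left; apply/eqP.
by apply: eq_integral => y /[!inE]/=; rewrite in_itv/= => /fg ->.
Qed.

Lemma int_oo c d f g : (forall y, c < y < d -> f y = g y) -> itg c d f ->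
  'I(c, d, f) = 'I(c, d, g).
Proof.
move=> fg F; have G := itg_oo fg F; rewrite /Rintegral.
rewrite !(integral_itv_bndoo true false); last 2 first.
- by apply: (measurable_funS _ _ (measurable_int mu G)) => //; apply: subset_itv; rewrite bnd_simp.
- by apply: (measurable_funS _ _ (measurable_int mu F)) => //; apply: subset_itv; rewrite bnd_simp.
by congr fine; apply: eq_integral => y /[!inE]/=; rewrite in_itv/= => /fg ->.
Qed.

Lemma int_eq c d f g : (forall y, c <= y <= d -> f y = g y) ->
  'I(c, d, f) = 'I(c, d, g).
Proof.
by move=> fg; apply: eq_Rintegral => y /[!inE]/=; rewrite in_itv/= => /fg ->.
Qed.

Lemma intD c d f g : itg c d f -> itg c d g ->
  'I(c, d, fun t => f t + g t) = 'I(c, d, f) + 'I(c, d, g).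
Proof. exact: RintegralD. Qed.

Lemma intB c d f g : itg c d f -> itg c d g ->
  'I(c, d, fun t => f t - g t) = 'I(c, d, f) - 'I(c, d, g).
Proof. exact: RintegralB. Qed.

Lemma intZ c d l f : itg c d f -> 'I(c, d, fun t => l * f t) = l * 'I(c, d, f).
Proof. exact: RintegralZl. Qed.

Lemma int_le c d f g : itg c d f -> itg c d g ->
  (forall y, c <= y <= d -> f y <= g y) -> 'I(c, d, f) <= 'I(c, d, g).
Proof.
by move=> F G fg; apply: le_Rintegral => // y /=; rewrite in_itv/= => /fg.
Qed.

Lemma int_ge0 c d f : (forall y, c <= y <= d -> 0 <= f y) -> 0 <= 'I(c, d, f).
Proof. by move=> f0; apply: Rintegral_ge0 => y /=; rewrite in_itv/= => /f0. Qed.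

Lemma int_abs c d f : itg c d f -> `|'I(c, d, f)| <= 'I(c, d, fun t => `|f t|).
Proof. exact: le_normr_Rintegral. Qed.

Lemma int_sub_ge0 c d c' d' f : c <= c' -> c' <= d' -> d' <= d -> itg c d f ->
  (forall y, c <= y <= d -> 0 <= f y) -> 'I(c', d', f) <= 'I(c, d, f).
Proof.
move=> cc cd dd F f0.
have F1 : itg c' d f by apply: itg_sub F.
rewrite (@int_split c c' d)// ?(le_trans cd)// (@int_split c' d' d)//.
rewrite addrCA lerDl addr_ge0// int_ge0// => y /andP[y1 y2]; apply: f0.
  by rewrite y1 (le_trans y2)// (le_trans cd).
by rewrite (le_trans _ y1)// (le_trans cc).
Qed.

Lemma int_ae_eq c d f g : (forall y, 0 <= f y) -> (forall y, 0 <= g y) ->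
  {ae mu, forall y, c <= y <= d -> f y = g y} -> 'I(c, d, f) = 'I(c, d, g).
Proof.
move=> f0 g0 fg; congr fine; apply/eqP; rewrite eq_le; apply/andP; split.
all: apply: ge0_ae_le_integral; rewrite /= ?lee_fin//.
all: refine (ae_imp _ fg) => y /= fgy; rewrite in_itv/= => /fgy ->; exact: lexx.
Qed.

Lemma itg_ae_le c d f g : measurable_fun `[c, d] f ->
  (forall y, 0 <= f y) -> (forall y, 0 <= g y) -> itg c d g ->
  {ae mu, forall y, c <= y <= d -> f y <= g y} ->
  itg c d f /\ 'I(c, d, f) <= 'I(c, d, g).
Proof.
move=> mf f0 g0 G fg.
have le : (\int[mu]_(x in `[c, d]) (f x)%:E <= \int[mu]_(x in `[c, d]) (g x)%:E)%E.
  apply: ge0_ae_le_integral; rewrite /= ?lee_fin//.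
have F : itg c d f.
  apply/integrableP; split; first exact/measurable_EFinP.
  have Gy : (\int[mu]_(x in `[c, d]) (EFin \o g) x < +oo)%E by exact: integrable_lty.
  apply: le_lt_trans Gy; apply: le_trans le; rewrite le_eqVlt; apply/orP; left; apply/eqP.
  by apply: eq_integral => y _; rewrite /= ger0_norm.
by split => //; apply: fine_le => //; exact: integrable_fin_num.
Qed.

Lemma int_ae_ge0 c d f : itg c d f ->
  {ae mu, forall y, c <= y <= d -> 0 <= f y} -> 0 <= 'I(c, d, f).
Proof.
move=> F f0; have G := itg_norm F.
suff -> : 'I(c, d, f) = 'I(c, d, fun t => `|f t|) by exact: int_ge0.
congr fine; apply: ae_eq_integral => //=.
- exact: measurable_int F.
- exact: measurable_int G.
- by refine (ae_imp _ f0) => y fy /=; rewrite in_itv/= => /fy h; rewrite ger0_norm.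
Qed.

Lemma itg_ess_bounded c d (L : R) f g : 0 <= L -> ess_bounded c d L f -> itg c d g ->
  itg c d (fun t => f t * g t) /\
  'I(c, d, fun t => `|f t * g t|) <= L * 'I(c, d, fun t => `|g t|).
Proof.
move=> L0 [mf fL] G; have G1 := itg_norm G.
have mfg : measurable_fun `[c, d] (fun t => f t * g t).
  by apply: measurable_funM => //; exact: itg_meas.
have [|||||H1 H2] := @itg_ae_le c d (fun t => `|f t * g t|) (fun t => L * `|g t|).
- exact: measurableT_comp mfg.
- by [].
- by move=> y; rewrite mulr_ge0.
- exact: itgZ.
- by refine (ae_imp _ fL) => y fy cyd; rewrite normrM ler_wpM2r// fy.
split; last by rewrite -(intZ L G1).
by apply: itg_le mfg _ H1 => y _; rewrite lexx.
Qed.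

(** * Absolutely continuous functions and their weak derivatives *)

Lemma weak_deriv_eq c d v g y z : weak_deriv c d v g -> c <= y -> y <= z -> z <= d ->
  v z = v y + 'I(y, z, g).
Proof.
move=> [G vE] cy yz zd.
rewrite (vE z) ?zd ?(le_trans cy)// (vE y) ?cy ?(le_trans yz)//.
by rewrite (@int_split c y z)// ?addrA//; apply: itg_sub G.
Qed.

Lemma weak_deriv_sub c d c' d' v g : c <= c' -> d' <= d ->
  weak_deriv c d v g -> weak_deriv c' d' v g.
Proof.
move=> cc dd H; split; first by case: H => G _; apply: itg_sub G.
by move=> y /andP[y1 y2]; apply: (weak_deriv_eq H); rewrite // (le_trans y2).
Qed.

Lemma weak_deriv_glue c m d v g : c <= m -> m <= d ->
  weak_deriv c m v g -> weak_deriv m d v g -> weak_deriv c d v g.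
Proof.
move=> cm md H1 H2; have G := itg_glue cm md H1.1 H2.1; split => // y /andP[cy yd].
have [ym|my] := leP y m; first by apply: H1.2; rewrite cy.
rewrite (@int_split c m y)// ?(ltW my)//; last exact: itg_sub G.
by rewrite addrA -(H1.2 m) ?cm ?lexx// -H2.2// (ltW my).
Qed.

Lemma weak_deriv_oo c d v g g' : (forall y, c < y < d -> g y = g' y) ->
  weak_deriv c d v g -> weak_deriv c d v g'.
Proof.
move=> gg [G H]; split; first exact: itg_oo gg G.
move=> y /andP[cy yd]; rewrite H ?cy//; congr (_ + _); apply: int_oo => [z /andP[z1 z2]|].
  by apply: gg; rewrite z1 (lt_le_trans z2).
by apply: itg_sub G.
Qed.

Lemma weak_deriv_ext c d v v' g : (forall y, c <= y <= d -> v y = v' y) ->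
  c <= d -> weak_deriv c d v g -> weak_deriv c d v' g.
Proof.
move=> vv cd [G H]; split=> // y cyd.
by rewrite -!vv ?lexx// ?cd// H.
Qed.

Lemma weak_derivD c d u g v k : weak_deriv c d u g -> weak_deriv c d v k ->
  weak_deriv c d (fun t => u t + v t) (fun t => g t + k t).
Proof.
move=> [G uE] [K vE]; split; first exact: itgD.
move=> y /[dup] cyd /andP[cy yd]; rewrite uE// vE// intD; last 2 first.
- exact: itg_sub G.
- exact: itg_sub K.
by rewrite addrACA.
Qed.

Lemma weak_derivZ c d l v k : weak_deriv c d v k ->
  weak_deriv c d (fun t => l * v t) (fun t => l * k t).
Proof.
move=> [K vE]; split; first exact: itgZ.
move=> y /[dup] cyd /andP[cy yd]; rewrite vE// intZ ?mulrDr//.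
exact: itg_sub K.
Qed.

Lemma weak_deriv_primitive c d g : c <= d -> itg c d g -> 
  weak_deriv c d (fun y => 'I(c, y, g)) g.
Proof. by move=> cd G; split => // y _; rewrite int_xx add0r. Qed.

Lemma weak_deriv_continuous c d v g : c <= d -> weak_deriv c d v g ->
  {within `[c, d], continuous v}.
Proof.
move=> cd [G vE].
have := parameterized_integral_continuous cd G.
rewrite /parameterized_integral => H.
have : {within `[c, d], continuous (fun y => v c + 'I(c, y, g))}.
  by move=> y; apply: cvgD; [exact: cvg_cst|exact: H].
apply: subspace_eq_continuous => y /[!inE] ycd; apply/esym/vE.
by move: ycd; rewrite /= in_itv.
Qed.

Lemma itg_continuous c d v : {within `[c, d], continuous v} -> itg c d v.
Proof.
by move=> cv; apply: continuous_compact_integrable => //; exact: segment_compact.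
Qed.

Lemma weak_deriv_itg c d v g : c <= d -> weak_deriv c d v g -> itg c d v.
Proof. by move=> cd /(weak_deriv_continuous cd)/itg_continuous. Qed.

Lemma weak_deriv_bound c d v g y z : weak_deriv c d v g -> c <= y <= d -> c <= z <= d ->
  `|v y - v z| <= 'I(c, d, fun t => `|g t|).
Proof.
move=> H; wlog yz : y z / y <= z.
  move=> hw y1 z1; have [|/ltW] := leP y z; first by move=> /hw; apply.
  by move=> /hw h; rewrite distrC h.
move=> /andP[cy yd] /andP[cz zd].
have G : itg y z g by apply: itg_sub H.1.
rewrite (weak_deriv_eq H cy yz zd) opprD addrA subrr add0r normrN.
rewrite (le_trans (int_abs G))// int_sub_ge0//; apply: itg_norm; exact: H.1.
Qed.

Lemma itg_mul_continuous c d v g : {within `[c, d], continuous v} ->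
  itg c d g -> itg c d (fun t => v t * g t).
Proof.
move=> cv G; have V := itg_continuous cv.
have [B hB] : exists B, forall y, c <= y <= d -> `|v y| <= B.
  have [dc|cd] := ltP d c.
    by exists 0 => y /andP[cy yd]; move: (le_trans cy yd); rewrite leNgt dc.
  have [y _ hy] := EVT_max cd cv; have [z _ hz] := EVT_min cd cv.
  exists (`|v y| + `|v z|) => t ct; rewrite ler_norml.
  have := hy t; have := hz t; rewrite in_itv/= ct => /(_ isT) h1 /(_ isT) h2.
  have := ler_norm (v y); have := ler_norm (- v z); rewrite normrN.
  have := normr_ge0 (v y); have := normr_ge0 (v z); lra.
apply: (@itg_le _ _ _ (fun t => B * `|g t|)).
- by apply: measurable_funM; exact: itg_meas.
- by move=> y /hB h; rewrite normrM ler_wpM2r.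
- by apply: itgZ; exact: itg_norm.
Qed.

Lemma EFin_int c d f : itg c d f ->
  ('I(c, d, f))%:E = (\int[mu]_(t in `[c, d]) (f t)%:E)%E.
Proof. by move=> F; rewrite /Rintegral fineK//; exact: integrable_fin_num. Qed.

(* Both sides are iterated integrals of [g x * k y] over [c <= x <= y <= d]. *)
Lemma weak_deriv_int_by_parts c d u g v k : c <= d ->
  weak_deriv c d u g -> weak_deriv c d v k ->
  'I(c, d, fun t => u t * k t + g t * v t) = u d * v d - u c * v c.
Proof.
move=> cd U V.
have cu := weak_deriv_continuous cd U; have cv := weak_deriv_continuous cd V.
have iuk := itg_mul_continuous cu V.1; have ivg := itg_mul_continuous cv U.1.
pose D := `[c, d]%classic.
have mD : measurable D by exact: measurable_itv.
pose gD := g \_ D; pose kD := k \_ D.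
have GD : mu.-integrable setT (EFin \o gD).
  by have /integrable_mkcond := U.1; rewrite restrict_EFin; apply.
have KD : mu.-integrable setT (EFin \o kD).
  by have /integrable_mkcond := V.1; rewrite restrict_EFin; apply.
have mg : measurable_fun setT gD by apply/measurable_EFinP; exact: measurable_int GD.
have mk : measurable_fun setT kD by apply/measurable_EFinP; exact: measurable_int KD.
pose T := [set z : R * R | z.1 <= z.2].
have mT : measurable T.
  rewrite -[T]setTI; apply: measurable_fun_le => //.
(* The cutoff to the triangle [T] makes one inner integral produce [v d - v x] and the other
   [u y - u c]. *)
pose F (z : R * R) := (gD z.1 * kD z.2 * \1_T z).
have mF : measurable_fun setT F.
  apply: measurable_funM; last exact: measurable_indic.
  by apply: measurable_funM; apply: measurableT_comp => //.
have iF : (mu \x mu)%E.-integrable setT (EFin \o F).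
  apply/integrable12ltyP; first exact/measurable_EFinP.
  have KN : mu.-integrable setT (fun y => `|kD y|%:E) by exact: (integrable_norm KD).
  have GN : mu.-integrable setT (fun y => `|gD y|%:E) by exact: (integrable_norm GD).
  (* [F] is dominated by a product of functions of one variable each, so the iterated integral of
     its modulus is at most a product of two finite integrals. *)
  pose K := (\int[mu]_y `|kD y|%:E)%E.
  have Kfin : K \is a fin_num by apply: integrable_fin_num KN.
  have fin : (\int[mu]_x ((fine K)%:E * `|gD x|%:E) < +oo)%E.
    apply: (@integrable_lty _ _ _ mu setT) => //.
    exact: (integrableZl _ (fine K) GN).
  apply: le_lt_trans fin; apply: ge0_ae_le_integral => /=.
  - by move=> x; apply: integral_ge0.
  - by move=> x; rewrite mule_ge0// lee_fin ?fine_ge0// integral_ge0.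
  apply: aeW => x _; rewrite fineK// muleC -ge0_integralZl_EFin//=; last first.
    exact: measurable_int KN.
  apply: ge0_ae_le_integral => //=.
  apply: aeW => y _; rewrite -EFinM lee_fin /F !normrM indicE.
  by rewrite ler_piMr ?mulr_ge0//; case: (_ \in _); rewrite ?normr1 ?normr0.
have := Fubini iF.
have L x : (\int[mu]_y (EFin \o F) (x, y) = ((fun x => g x * (v d - v x)) \_ D x)%:E)%E.
  rewrite [in RHS]/patch; case: ifPn => [/[!inE] xD|xD]; last first.
    by rewrite integral0_eq// => y _; rewrite /F /= /gD /patch (negbTE xD) !mul0r.
  have /andP[cx xd] : c <= x <= d by move: xD; rewrite /D /= in_itv.
  have K : itg x d k by apply: itg_sub V.1.
  have -> : v d - v x = 'I(x, d, k).
    by rewrite (weak_deriv_eq V cx xd)// addrAC subrr add0r.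
  rewrite -(intZ _ K) EFin_int; last exact: itgZ.
  rewrite [RHS]integral_mkcond; apply: eq_integral => y _.
  rewrite /F /= /gD /kD /patch mem_set// indicE /T.
  have -> : ((x, y) \in [set z : R * R | z.1 <= z.2]) = (x <= y) by apply/idP/idP; rewrite inE.
  rewrite /D !mem_setE !in_itv/=; case: (leP x y) => xy /=; last by rewrite mulr0.
  by rewrite (le_trans cx xy) /=; case: ifP; rewrite ?mulr1// mulr0.
have Rr y : (\int[mu]_x (EFin \o F) (x, y) = ((fun y => (u y - u c) * k y) \_ D y)%:E)%E.
  rewrite [in RHS]/patch; case: ifPn => [/[!inE] yD|yD]; last first.
    by rewrite integral0_eq// => x _; rewrite /F /= /kD /patch (negbTE yD) mulr0 mul0r.
  have /andP[cy yd] : c <= y <= d by move: yD; rewrite /D /= in_itv.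
  have K : itg c y g by apply: itg_sub U.1.
  have -> : u y - u c = 'I(c, y, g).
    by rewrite (weak_deriv_eq U _ cy yd)// addrAC subrr add0r.
  rewrite mulrC -(intZ _ K) EFin_int; last exact: itgZ.
  rewrite [RHS]integral_mkcond; apply: eq_integral => x _.
  rewrite /F /= /gD /kD /patch (mem_set yD) indicE /T.
  have -> : ((x, y) \in [set z : R * R | z.1 <= z.2]) = (x <= y) by apply/idP/idP; rewrite inE.
  rewrite /D !mem_setE !in_itv/=; case: (leP x y) => xy /=; last by rewrite andbF mulr0.
  rewrite (le_trans xy yd) andbT; case: ifP; rewrite ?mulr1 ?mul0r// mulrC//.
have -> : (\int[mu]_x \int[mu]_y (EFin \o F) (x, y) =
           \int[mu]_(x in D) (g x * (v d - v x))%:E)%E.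
  rewrite [RHS]integral_mkcond (_ : _ \_ D = EFin \o ((fun x => g x * (v d - v x)) \_ D)); last by rewrite -restrict_EFin.
  by apply: eq_integral => x _; exact: L.
have -> : (\int[mu]_y \int[mu]_x (EFin \o F) (x, y) =
           \int[mu]_(y in D) ((u y - u c) * k y)%:E)%E.
  rewrite [RHS]integral_mkcond (_ : _ \_ D = EFin \o ((fun y => (u y - u c) * k y) \_ D)); last by rewrite -restrict_EFin.
  by apply: eq_integral => x _; exact: Rr.
move=> /(congr1 fine) H.
(* Once both sides are expanded, the integrals of [g] and [k] are the increments of [u] and [v], and
   the formula follows by linear arithmetic. *)
have {H} : 'I(c, d, fun x => v d * g x - v x * g x) =
    'I(c, d, fun y => u y * k y - u c * k y).
  rewrite (@int_eq c d _ (fun x => g x * (v d - v x))); last by move=> y _; ring.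
  transitivity ('I(c, d, fun y => (u y - u c) * k y)); first exact: H.
  by apply: int_eq => y _; ring.
rewrite (intB (itgZ _ U.1) ivg) (intB iuk (itgZ _ V.1)) !(intZ _ U.1, intZ _ V.1).
have := weak_deriv_eq U (lexx c) cd (lexx d); have := weak_deriv_eq V (lexx c) cd (lexx d).
rewrite (@int_eq c d (fun t => u t * k t + g t * v t) (fun t => u t * k t + v t * g t)); last by move=> y _; ring.
rewrite (intD iuk ivg) => -> ->; lra.
Qed.

Lemma weak_derivM c d u g v k : c <= d ->
  weak_deriv c d u g -> weak_deriv c d v k ->
  weak_deriv c d (fun t => u t * v t) (fun t => u t * k t + g t * v t).
Proof.
move=> cd U V; split.
  apply: itgD; first by apply: itg_mul_continuous V.1; exact: weak_deriv_continuous U.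
  rewrite (_ : (fun t => g t * v t) = (fun t => v t * g t)); last first.
    by apply/funext => t; rewrite mulrC.
  by apply: itg_mul_continuous U.1; exact: weak_deriv_continuous V.
move=> y /andP[cy yd].
rewrite (weak_deriv_int_by_parts cy (weak_deriv_sub _ yd U) (weak_deriv_sub _ yd V))// addrC subrK//.
Qed.

Lemma weak_deriv_poly c d (p : {poly R}) : c <= d ->
  weak_deriv c d (fun y => p.[y]) (fun y => p^`().[y]).
Proof.
move=> cd; have G : itg c d (fun y => p^`().[y]).
  apply: itg_continuous; apply: continuous_subspaceT; exact: continuous_horner.
split => // y /andP[]; rewrite le_eqVlt => /predU1P[->|cy yd].
  by rewrite int_xx addr0.
rewrite /Rintegral (@continuous_FTC2 _ _ (horner p) c y)//=; first by rewrite addrCA subrr addr0.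
- apply: continuous_subspaceT; exact: continuous_horner.
- split => [z _||].
  + exact: derivable_horner.
  + by apply: cvg_at_right_filter; exact: continuous_horner.
  + by apply: cvg_at_left_filter; exact: continuous_horner.
- by move=> z _; rewrite -derivE.
Qed.

(** * Classical derivatives against weak derivatives *)

Lemma derive1_oo c d f g y : (forall z, c < z < d -> f z = g z) -> c < y < d ->
  derivable f y 1 -> derivable g y 1 /\ derive1 g y = derive1 f y.
Proof.
move=> fg cyd Df.
have N : {near y, f =1 g}.
  near=> z; apply: fg.
  have : z \in `]c, d[ by near: z; apply: near_in_itvoo; rewrite in_itv.
  by rewrite in_itv.
split; first exact: near_eq_derivable Df.
by rewrite !derive1E; apply/esym; exact: near_eq_derive.
Unshelve. all: by end_near. Qed.

(** Differentiability is not assumed because the lemma serves for the second derivative, which may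
    fail to exist on a null set. *)
Lemma derive1_eq_oo c d f g y : (forall z, c < z < d -> f z = g z) -> c < y < d ->
  derive1 g y = derive1 f y.
Proof.
move=> fg cyd; rewrite !derive1E; apply/esym; apply: near_eq_derive.
near=> z; apply: fg.
have : z \in `]c, d[ by near: z; apply: near_in_itvoo; rewrite in_itv.
by rewrite in_itv.
Unshelve. all: by end_near. Qed.

Lemma derive1_shift l f y : derivable f y 1 ->
  derivable (fun z => l + f z) y 1 /\ derive1 (fun z => l + f z) y = derive1 f y.
Proof.
move=> Df; have Dc := derivable_cst l y (1 : R); split; first exact: derivableD.
by rewrite !derive1E (deriveD Dc Df) derive_cst add0r.
Qed.

Lemma weak_deriv_derive1 c d v k y : c < d -> weak_deriv c d v k ->
  {within `[c, d], continuous k} -> c < y < d ->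
  derivable v y 1 /\ derive1 v y = k y.
Proof.
move=> cd V ck /[dup] cyd /andP[cy yd].
have ky : {for y, continuous k}.
  by have [+ _ _] := (continuous_within_itvP _ cd).1 ck; apply; rewrite in_itv.
have [D1 D2] := continuous_FTC1_closed yd V.1 cy ky.
have [D3 D4] := derive1_shift (v c) D1.
have E z : c < z < d -> v c + 'I(c, z, k) = v z.
  by move=> /andP[/ltW cz /ltW zd]; rewrite -V.2 ?cz.
have [D5 D6] := derive1_oo E cyd D3.
by split => //; rewrite D6 D4 D2.
Qed.

(** This is Lebesgue's differentiation theorem; [g] is extended by zero to be locally integrable on
    the whole line. *)
Lemma weak_deriv_ae_derive1 c d k g : c < d -> weak_deriv c d k g ->
  {ae mu, forall y, c < y < d -> derive1 k y = g y}.
Proof.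
move=> cd V; pose gD := g \_ `[c, d].
have GD : mu.-integrable setT (EFin \o gD).
  by have /integrable_mkcond := V.1; rewrite restrict_EFin; apply.
have GDc y : mu.-integrable `[c, y] (EFin \o gD) by exact: integrableS GD.
have loc : locally_integrable [set: R] gD by apply: integrable_locally V.1.
have := FTC1 GDc loc.
apply: ae_imp => y /= + /[dup] cyd /andP[cy yd] => /(_ cy)[D1 D2].
have [D3 D4] := derive1_shift (k c) D1.
have E z : c < z < d -> k c + 'I(c, z, gD) = k z.
  move=> /andP[/ltW cz /ltW zd]; rewrite (V.2 z) ?cz//; congr (_ + _).
  apply: int_eq => t /andP[ct tz]; rewrite /gD /patch mem_set//= in_itv/= ct.
  exact: le_trans zd.
have [D5 ->] := derive1_oo E cyd D3.
by rewrite D4 D2 /gD /patch mem_set//= in_itv/= !ltW.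
Qed.

Lemma L2_itg_sq c d g : L2 c d g -> itg c d (fun t => g t ^+ 2).
Proof.
move=> [mg Gy]; apply/integrableP; split.
  by apply/measurable_EFinP; exact: measurable_funX.
apply: le_lt_trans Gy; rewrite le_eqVlt; apply/orP; left; apply/eqP.
by apply: eq_integral => y _; rewrite /= ger0_norm ?sqr_ge0.
Qed.

Lemma int_ae_oo c d f g : (forall y, 0 <= f y) -> (forall y, 0 <= g y) ->
  {ae mu, forall y, c < y < d -> f y = g y} -> 'I(c, d, f) = 'I(c, d, g).
Proof.
move=> f0 g0 fg; apply: int_ae_eq => //.
case: fg => A [mA A0 fgA]; exists (A `|` ([set c] `|` [set d])); split.
- by do 2! apply: measurableU => //.
- have m2 : mu ([set c] `|` [set d]) = 0%E.
    by rewrite measureU0//; exact: lebesgue_measure_set1.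
  by rewrite measureU0//; exact: measurableU.
- move=> y /= nfg; have [-> |yc] := eqVneq y c; first by right; left.
  have [-> |yd] := eqVneq y d; first by right; right.
  left; apply: fgA => /= h; apply: nfg => /andP[cy yd']; apply: h.
  by rewrite !lt_neqAle cy yd' yd eq_sym yc.
Qed.

(** The bridge from the classical derivatives in [norm_P] to weak ones, which are additive. Since
    [k] is continuous it equals v' at every interior point, whereas [g] equals v'' only almost
    everywhere. *)
Lemma int_derive1_sq c d v k g : c < d ->
  weak_deriv c d v k -> weak_deriv c d k g ->
  'I(c, d, fun t => derive1 v t ^+ 2) = 'I(c, d, fun t => k t ^+ 2) /\
  'I(c, d, fun t => derive1n 2 v t ^+ 2) = 'I(c, d, fun t => g t ^+ 2).
Proof.
move=> cd V K; have ck := weak_deriv_continuous (ltW cd) K.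
have E y : c < y < d -> k y = derive1 v y.
  by move=> cyd; have [] := weak_deriv_derive1 cd V ck cyd.
split.
  by apply: int_ae_oo => [y|y|]; rewrite ?sqr_ge0//; apply: aeW => y /E ->.
apply: int_ae_oo => [y|y|]; rewrite ?sqr_ge0//.
refine (ae_imp _ (weak_deriv_ae_derive1 cd K)) => y /= Hy cyd.
by rewrite -Hy// (derive1_eq_oo E cyd).
Qed.

(** Cauchy-Schwarz against the constant 1, from integrating [(|f| - s)^2 >= 0] with [s] the mean
    value of [|f|]. *)
Lemma int_sq c d f : c < d -> itg c d f -> itg c d (fun t => f t ^+ 2) ->
  'I(c, d, fun t => `|f t|) ^+ 2 <= (d - c) * 'I(c, d, fun t => f t ^+ 2).
Proof.
move=> cd F F2; have F1 := itg_norm F.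
set I1 := 'I(c, d, fun t => `|f t|); set I2 := 'I(c, d, fun t => f t ^+ 2).
have dc : 0 < d - c by rewrite subr_gt0.
pose s := I1 / (d - c).
have : 'I(c, d, fun t => 2 * s * `|f t| - s ^+ 2) <= I2.
  apply: int_le => //; first by apply: itgB; [exact: itgZ|exact: itg_cst].
  move=> y _; have := sqr_ge0 (`|f y| - s); rewrite -(real_normK (num_real (f y))).
  nra.
rewrite intB; [|exact: itgZ|exact: itg_cst].
rewrite intZ// (int_cst _ (ltW cd)) -/I1 => h.
suff E :  I1 ^+ 2 = (d - c) * (2 * s * I1 - s ^+ 2 * (d - c)).
  by rewrite E ler_wpM2l// ltW.
by rewrite /s; field; rewrite gt_eqF.
Qed.

(* A point value is compared with the mean value over the interval. *)
Lemma weak_deriv_point_bound c d k g y : c < d -> weak_deriv c d k g -> L2 c d g ->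
  c <= y <= d ->
  (d - c) * k y ^+ 2 <= 2 * ('I(c, d, fun t => k t ^+ 2) +
                             (d - c) ^+ 2 * 'I(c, d, fun t => g t ^+ 2)).
Proof.
move=> cd K G ycd.
have ik := weak_deriv_itg (ltW cd) K; have cK := weak_deriv_continuous (ltW cd) K.
have ik2 : itg c d (fun t => k t ^+ 2) by apply: itg_mul_continuous.
have hg := int_sq cd K.1 (L2_itg_sq G).
have hk := int_sq cd ik ik2.
have nk := itg_norm ik.
have dc : 0 < d - c by rewrite subr_gt0.
set A := 'I(c, d, fun t => `|k t|) in hk *.
set B := 'I(c, d, fun t => `|g t|) in hg *.
have B0 : 0 <= B by apply: int_ge0.
have A0 : 0 <= A by apply: int_ge0.
have h : (d - c) * `|k y| <= A + (d - c) * B.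
  rewrite mulrC -(int_cst _ (ltW cd)) [X in _ + X]mulrC -(int_cst _ (ltW cd)) -intD//; last exact: itg_cst.
  apply: int_le; [exact: itg_cst|apply: itgD => //; exact: itg_cst|].
  move=> t tcd; have := weak_deriv_bound K ycd tcd.
  have := ler_normD (k t) (k y - k t); rewrite addrC subrK -/B; lra.
rewrite -(real_normK (num_real (k y))).
have y0 := normr_ge0 (k y).
have h2 : ((d - c) * `|k y|) ^+ 2 <= (A + (d - c) * B) ^+ 2.
  by rewrite ler_sqr ?nnegrE ?addr_ge0 ?mulr_ge0 ?(ltW dc).
rewrite -(ler_pM2l dc).
have h3 : (A + (d - c) * B) ^+ 2 <= 2 * (A ^+ 2 + (d - c) ^+ 2 * B ^+ 2).
  have := sqr_ge0 (A - (d - c) * B); nra.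
have h4 : (d - c) ^+ 2 * B ^+ 2 <=
    (d - c) ^+ 2 * ((d - c) * 'I(c, d, fun t => g t ^+ 2)).
  by rewrite ler_wpM2l ?sqr_ge0.
move: h2 h3 h4 hk; set X := 'I(c, d, fun t => k t ^+ 2); set Y := 'I(c, d, fun t => g t ^+ 2).
clearbody A B X Y; clear - R; move: (d - c) (`|k y|) => D z; lra.
Qed.

End Integral.

(** * Gauss quadrature from the orthogonality of the Legendre polynomial *)

Section Quadrature.
Context {R : realType}.
Local Notation mu := (@lebesgue_measure R).
Local Notation itg c d f := (mu.-integrable `[c, d] (EFin \o f)).
Local Notation "''I' ( c , d , f )" := (\int[mu]_(t in `[c, d]) f t).
Implicit Types (c d m l : R) (f g k u v : R -> R).

Lemma sum_CS (I : Type) (s : seq I) (P : pred I) (p q : I -> R) :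
  (\sum_(i <- s | P i) p i * q i) ^+ 2 <=
  (\sum_(i <- s | P i) p i ^+ 2) * (\sum_(i <- s | P i) q i ^+ 2).
Proof.
elim: s => [|i s IH]; first by rewrite !big_nil expr0n mul0r.
rewrite !big_cons; case: (P i) => //.
set S := \sum_(_ <- _ | _) _ in IH *; set A := \sum_(_ <- _ | _) _ in IH *.
set B := \sum_(_ <- _ | _) _ in IH *.
have A0 : 0 <= A by apply: sumr_ge0 => j _; exact: sqr_ge0.
have B0 : 0 <= B by apply: sumr_ge0 => j _; exact: sqr_ge0.
move: S A B A0 B0 IH (p i) (q i) => S A B A0 B0 IH x y.
(* The cross term is bounded after squaring: the induction hypothesis replaces [S ^+ 2] by [A * B],
   and the arithmetic-geometric inequality does the rest. *)
suff H : 2 * (S * (x * y)) <= x ^+ 2 * B + y ^+ 2 * A by lra.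
have h0 : 0 <= x ^+ 2 * B + y ^+ 2 * A by rewrite addr_ge0// mulr_ge0// sqr_ge0.
apply: le_trans (ler_norm _) _; rewrite -ler_sqr ?nnegrE// real_normK ?num_real//.
have := ler_wpM2l (sqr_ge0 (x * y)) IH.
have := sqr_ge0 (x ^+ 2 * B - y ^+ 2 * A); lra.
Qed.

Lemma int_deriv c d (p : {poly R}) : c <= d ->
  'I(c, d, horner p^`()) = p.[d] - p.[c].
Proof.
by move=> cd; rewrite [p.[d]](weak_deriv_eq (weak_deriv_poly p cd) (lexx c) cd (lexx d)) addrAC subrr add0r.
Qed.

Lemma itg_poly c d (p : {poly R}) : itg c d (horner p).
Proof.
by apply: itg_continuous; apply: continuous_subspaceT; exact: continuous_horner.
Qed.

Lemma poly_primitive (p : {poly R}) : exists P : {poly R}, P^`() = p.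
Proof.
exists (\poly_(i < (size p).+1) (p`_i.-1 / i%:R)); apply/polyP => i.
rewrite coef_deriv coef_poly ltnS; case: ltnP => [_|ip]; last first.
  by rewrite nth_default// mul0rn.
by rewrite /= -[LHS]mulr_natr divfK// pnatr_eq0.
Qed.

Lemma deriv_affine (p : {poly R}) (m l : R) :
  (p \Po (m%:P + l *: 'X))^`() = l *: (p^`() \Po (m%:P + l *: 'X)).
Proof.
by rewrite deriv_comp derivD derivC add0r derivZ derivX alg_polyC mulrC mul_polyC.
Qed.

(** Both sides are the same increment of a polynomial primitive of [p], so the substitution is pure
    algebra. *)
Lemma int_poly_affine c d (p : {poly R}) : c <= d ->
  'I(c, d, horner p) = (d - c) / 2 *
    'I(-1, 1, horner (p \Po (((c + d) / 2)%:P + ((d - c) / 2) *: 'X))).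
Proof.
move=> cd; have [P <-] := poly_primitive p; rewrite int_deriv//.
rewrite -intZ; last exact: itg_poly.
under eq_Rintegral do rewrite -hornerZ.
rewrite -deriv_affine int_deriv; last lra.
rewrite !horner_comp !hornerE; congr (_.[_] - _.[_]); lra.
Qed.

Lemma poly_int_gt0 (p : {poly R}) : (forall y, -1 <= y <= 1 -> 0 <= p.[y]) ->
  p != 0 -> 0 < 'I(-1, 1, horner p).
Proof.
move=> p0 pN0; rewrite lt_neqAle int_ge0// andbT; apply: contraNneq pN0 => I0.
have pr y : -1 < y < 1 -> root p y.
  move=> y1; have cp : {within `[-1, 1], continuous (horner p)}.
    by apply: continuous_subspaceT; exact: continuous_horner.
  (* A nonnegative integrand with zero total integral has zero partial integrals, so [p] is the
     continuous weak derivative of the zero function and vanishes inside the interval. *)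
  have V : weak_deriv (-1) 1 (cst 0) (horner p).
    split; first exact: itg_poly.
    move=> z /andP[z1 z2]; rewrite add0r; apply/esym/le_anti/andP; split.
      rewrite [leRHS]I0; apply: int_sub_ge0 => //; exact: itg_poly.
    by apply: int_ge0 => t /andP[t1 t2]; apply: p0; rewrite t1 (le_trans t2).
  have lt11 : -1 < 1 :> R by lra.
  have [_] := weak_deriv_derive1 lt11 V cp y1.
  by rewrite derive1_cst => /esym/eqP.
(* The points [1 / (n + 2)] are distinct and lie in the interval; [size p] of them are too many
   roots for a nonzero [p]. *)
apply/eqP; apply: (@roots_geq_poly_eq0 _ p [seq (n.+2%:R)^-1 | n <- iota 0 (size p)]).
- apply/allP => _ /mapP[k _ ->]; apply: pr.
  rewrite invf_lt1 ?ltr1n// andbT (lt_trans (_ : _ < 0))// ?invr_gt0//; lra.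
- rewrite map_inj_uniq ?iota_uniq// => i j /invr_inj/eqP.
  by rewrite eqr_nat => /eqP[].
- by rewrite size_map size_iota.
Qed.

Lemma dvdp_deriv_exp (a : R) (m : nat) (p : {poly R}) :
  ('X - a%:P) ^+ m.+1 %| p -> ('X - a%:P) ^+ m %| p^`().
Proof.
move=> /dvdpP[q ->]; rewrite derivM deriv_exp derivXsubC mul1r dvdp_add//.
  by rewrite exprS mulrA dvdp_mull.
by rewrite dvdp_mull// -mulr_natr dvdp_mulr.
Qed.

(** Repeated integration by parts in Rodrigues' formula. No boundary term appears because 1 and -1
    are roots of [W] of multiplicity at least [n], hence roots of every derivative of order below
    [n], while each step also lowers the degree of [q]. *)
Lemma legendre_ortho n (q : {poly R}) : (size q <= n)%N ->
  'I(-1, 1, horner (legendre n * q)) = 0.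
Proof.
move=> qn; rewrite /legendre.
set W := ('X ^+ 2 - 1) ^+ n.
have Wroot a j : a ^+ 2 = 1 -> (j < n)%N -> W^`(j).[a] = 0.
  move=> a1 jn; apply/eqP; rewrite -/(root _ _) -dvdp_XsubCl.
  have : ('X - a%:P) ^+ (n - j) %| W^`(j).
    elim: j jn => [|j IH] jn.
      rewrite subn0 derivn0 /W (_ : 'X ^+ 2 - 1 = ('X - a%:P) * ('X + a%:P)).
        by rewrite exprMn dvdp_mulr.
      by rewrite -subr_sqr -polyC_exp a1.
    by rewrite derivnS; apply: dvdp_deriv_exp; rewrite subnSK ?IH// ltnW.
  by apply: dvdp_trans; rewrite -(subnSK jn) exprS dvdp_mulr.
have H j : (j <= n)%N -> forall q : {poly R}, (size q <= j)%N ->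
    'I(-1, 1, horner (W^`(j) * q)) = 0.
  elim: j => [|j IH] jn {qn}q qj.
    move: qj; rewrite leqn0 size_poly_eq0 => /eqP ->.
    by rewrite mulr0 (int_eq (g := fun=> 0)) => [|y _]; rewrite ?horner0// int_cst ?mul0r//; lra.
  have := @int_deriv (-1) 1 (W^`(j) * q); rewrite !hornerM !Wroot ?sqrrN ?expr1n//.
  have lt11 : -1 <= 1 :> R by lra.
  move=> /(_ lt11); rewrite !mul0r subr0 derivM.
  rewrite (int_eq (g := fun y => (W^`(j)^`() * q).[y] + (W^`(j) * q^`()).[y])); last first.
    by move=> y _; rewrite hornerD.
  rewrite intD ?IH ?addr0//; try exact: itg_poly; first exact: ltnW.
  have [->|q0] := eqVneq q 0; first by rewrite deriv0 size_poly0.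
  by rewrite -ltnS (leq_trans (lt_size_deriv q0)).
rewrite (int_eq (g := fun y => (2 ^+ n * n`!%:R)^-1 * (W^`(n) * q).[y])); last first.
  by move=> y _; rewrite -scalerAl hornerZ.
by rewrite intZ ?H ?mulr0//; exact: itg_poly.
Qed.

Lemma size_comp_affine (p : {poly R}) (m l : R) :
  (size (p \Po (m%:P + l *: 'X)) <= size p)%N.
Proof.
have [->|p0] := eqVneq p 0; first by rewrite comp_poly0.
rewrite (leq_trans (size_comp_poly_leq _ _))// -[leqRHS]prednK ?size_poly_gt0//.
rewrite ltnS -[leqRHS]muln1 leq_mul2l; apply/orP; right.
have : (size (m%:P + l *: 'X)%R <= 2)%N; last by case: size => [|[|[|]]].
rewrite (leq_trans (size_polyD _ _))// geq_max (leq_trans (size_polyC_leq1 _))//=.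
by rewrite (leq_trans (size_scale_leq _ _))// size_polyX.
Qed.

Section Gauss.
Variables (r : nat) (G : nat -> R).
Hypotheses (hr : (1 <= r)%N) (hG : gauss_points r G).
Local Notation s := (index_iota 1 r.+1).
Local Notation L := (legendre r : {poly R}).
Let W : {poly R} := ('X ^+ 2 - 1) ^+ r.
Let nodal : {poly R} := \prod_(j <- s) ('X - (G j)%:P).
Let conodal j : {poly R} := \prod_(i <- s | i != j) ('X - (G i)%:P).
Let lag j : {poly R} := (conodal j).[G j]^-1 *: conodal j.
(** Half the usual Gauss weight: the weights then add up to one, and the rule on [[c, d]] carries
    the factor [d - c]. *)
Let weight j : R := 'I(-1, 1, horner (lag j)) / 2.

Let mem_s j : (j \in s) = (1 <= j <= r)%N.
Proof. by rewrite mem_index_iota ltnS. Qed.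

Let node_inj i j : i \in s -> j \in s -> (G i == G j) = (i == j).
Proof.
rewrite !mem_s => /andP[i1 ir] /andP[j1 jr]; have [_ Gm] := hG.
have [ij|ij|->] := ltngtP i j; last by rewrite eqxx.
- by rewrite lt_eqF// Gm.
- by rewrite gt_eqF// Gm.
Qed.

Let uniq_nodes : uniq [seq G j | j <- s].
Proof.
rewrite map_inj_in_uniq ?iota_uniq// => i j si sj /eqP.
by rewrite node_inj// => /eqP.
Qed.

Let size_W : size W = (2 * r).+1.
Proof.
have X2 : size ('X ^+ 2 - 1 : {poly R}) = 3 by rewrite -polyC1 size_XnsubC.
have W0 : W != 0 by rewrite expf_neq0// -size_poly_gt0 X2.
by rewrite -[LHS]prednK ?size_poly_gt0// size_exp X2.
Qed.

Let coefL i : L`_i = (2 ^+ r * r`!%:R)^-1 * (W`_(r + i) *+ (r + i) ^_ r).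
Proof. by rewrite /legendre coefZ coef_derivn. Qed.

Let L_neq0 : L != 0.
Proof.
apply/eqP => L0; have := coefL r; rewrite L0 coef0 => /esym/eqP.
rewrite addnn -mul2n (_ : W`_(2 * r) = 1); last first.
  have : W \is monic by rewrite monic_exp// -polyC1 monicXnsubC.
  by move=> /monicP; rewrite lead_coefE size_W.
apply/negP; rewrite mulf_neq0// ?invr_neq0 ?mulf_neq0 ?expf_neq0//.
all: by rewrite pnatr_eq0 -lt0n ?fact_gt0// ffact_gt0 mul2n -addnn leq_addr.
Qed.

Let size_L : (size L <= r.+1)%N.
Proof.
apply/leq_sizeP => i ri; rewrite coefL nth_default ?mul0rn ?mulr0// size_W.
by rewrite mul2n -addnn -addnS leq_add2l.
Qed.

Let root_L j : j \in s -> root L (G j).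
Proof. by rewrite mem_s => js; have [/(_ _ js)[]] := hG. Qed.

Let size_nodal : size nodal = r.+1.
Proof. by rewrite size_prod_XsubC size_iota subn1. Qed.

Let nodal_neq0 : nodal != 0.
Proof. by rewrite -size_poly_gt0 size_nodal. Qed.

(** The [r] nodes are distinct roots of the nonzero polynomial [L] of degree at most [r], so [L] is
    a nonzero constant times [nodal] and passes on its orthogonality. *)
Let nodal_ortho (q : {poly R}) : (size q <= r)%N -> 'I(-1, 1, horner (q * nodal)) = 0.
Proof.
move=> qr; have LE : L = (L %/ nodal) * nodal.
  rewrite divpK// /nodal -[X in X %| _](big_map G xpredT (fun z => 'X - z%:P)).
  apply: uniq_roots_dvdp; last by rewrite uniq_rootsE.
  by apply/allP => _ /mapP[j js ->]; exact: root_L.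
have /size_poly1P[l l0 lE] : size (L %/ nodal) == 1%N.
  rewrite eqn_leq; apply/andP; split.
    by rewrite size_divp// size_nodal leq_subLR addn1.
  by rewrite size_poly_gt0; apply: contraNneq L_neq0 => q0; rewrite LE q0 mul0r.
have := legendre_ortho qr; rewrite LE lE mul_polyC.
rewrite (int_eq (g := fun y => l * (q * nodal).[y])); last first.
  by move=> y _; rewrite mulrC -scalerAr hornerZ.
rewrite intZ; last exact: itg_poly.
by move=> /eqP; rewrite mulf_eq0 (negbTE l0) => /eqP.
Qed.

(** Strictness keeps Gauss points away from the mesh nodes, where v' need not exist. If
    [L = q * (X - a)] with [a] equal to 1 or -1, orthogonality to [q] would make the integral of
    [(X - a) q^2] vanish, although [X - a] has a constant sign on the interval. *)
Lemma gauss_point_lt1 j : (1 <= j <= r)%N -> -1 < G j < 1.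
Proof.
move=> jr; have [/(_ _ jr)[/andP[G1 G2] rG] _] := hG.
have H a : a ^+ 2 = 1 -> root L a -> False.
  move=> a1; rewrite -dvdp_XsubCl => /dvdpP[q LE].
  have q0 : q != 0 by apply: contraNneq L_neq0 => q0; rewrite LE q0 mul0r.
  have sq : (size q <= r)%N.
    by have := size_L; rewrite LE size_Mmonic ?monicXsubC// size_XsubC addn2.
  have := legendre_ortho sq.
  (* With [a ^+ 2 = 1] one has [X - a = - a (1 - a X)], and [1 - a X] is nonnegative on the interval
     for both values of [a]. *)
  have -> : L * q = - a *: ((1 - a *: 'X) * q ^+ 2).
    rewrite LE -!mul_polyC polyCN.
    have : (a%:P) ^+ 2 = 1 :> {poly R} by rewrite -polyC_exp a1.
    by move: (a%:P) => z z1; ring: z1.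
  rewrite (int_eq (g := fun y => - a * ((1 - a *: 'X) * q ^+ 2).[y])); last first.
    by move=> y _; rewrite hornerZ.
  rewrite intZ; last exact: itg_poly.
  move=> /eqP; rewrite mulf_eq0 oppr_eq0 => /orP[/eqP a0|].
    by move: a1; rewrite a0 expr0n => /eqP; rewrite eq_sym oner_eq0.
  apply/negP; rewrite gt_eqF//; apply: poly_int_gt0.
    move=> y /andP[y1 y2]; rewrite hornerM horner_exp mulr_ge0 ?sqr_ge0// !hornerE.
    have /orP[/eqP ->|/eqP ->] : (a == 1) || (a == -1) by rewrite -sqrf_eq1 a1.
      lra.
    lra.
  rewrite mulf_neq0 ?expf_neq0//; apply/eqP => /(congr1 (fun p : {poly R} => p.[0])).
  by rewrite !hornerE subr0 => /eqP; rewrite oner_eq0.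
rewrite !lt_neqAle G1 G2 !andbT; apply/andP; split.
  by apply/eqP => e; apply: (H (-1)); rewrite ?sqrrN ?expr1n// e.
by apply/eqP => e; apply: (H 1); rewrite ?expr1n// -e.
Qed.

Let conodal_neq0 i : i \in s -> (conodal i).[G i] != 0.
Proof.
move=> si; rewrite horner_prod prodf_seq_neq0; apply/allP => j sj; apply/implyP => ji.
by rewrite hornerXsubC subr_eq0 node_inj// eq_sym.
Qed.

Let lag_node i j : i \in s -> j \in s -> (lag j).[G i] = (i == j)%:R.
Proof.
move=> si sj; rewrite hornerZ; have [->|ij] := eqVneq i j.
  by rewrite mulVf// conodal_neq0.
have -> : (conodal j).[G i] = 0; last by rewrite mulr0.
by rewrite /conodal (big_rem i)//= ij hornerM hornerXsubC subrr mul0r.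
Qed.

Let size_lag j : j \in s -> (size (lag j) <= r)%N.
Proof.
move=> sj; rewrite (leq_trans (size_scale_leq _ _))// /conodal -big_filter.
rewrite size_prod_XsubC -(rem_filter _ (iota_uniq _ _)) size_rem// size_iota.
by rewrite subn1 /= prednK.
Qed.

Let interpolation (q : {poly R}) : (size q <= r)%N ->
  q = \sum_(j <- s) q.[G j] *: lag j.
Proof.
move=> qr; apply/eqP; rewrite -subr_eq0; apply/eqP.
apply: (@roots_geq_poly_eq0 _ _ [seq G j | j <- s]).
- apply/allP => _ /mapP[i si ->]; rewrite /root hornerD hornerN horner_sum.
  rewrite (big_rem i)//= hornerZ lag_node// eqxx mulr1 big_seq big1 ?addr0 ?subrr//.
  move=> j; rewrite (rem_filter _ (iota_uniq _ _)) mem_filter => /andP[/= ji sj].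
  by rewrite hornerZ lag_node// eq_sym (negbTE ji) mulr0.
- exact: uniq_nodes.
- rewrite size_map size_iota subn1 (leq_trans (size_polyD _ _))// geq_max qr size_polyN.
  rewrite (leq_trans (size_sum _ _ _))//; apply/bigmax_leqP_seq => j sj _.
  by rewrite (leq_trans (size_scale_leq _ _))// size_lag.
Qed.

Let int_sum_poly (I : Type) (t : seq I) (l : I -> R) (p : I -> {poly R}) c d : c <= d ->
  'I(c, d, horner (\sum_(j <- t) l j *: p j)) = \sum_(j <- t) l j * 'I(c, d, horner (p j)).
Proof.
move=> cd; elim: t => [|j t IH].
  by rewrite !big_nil (int_eq (g := fun=> 0)) => [|y _]; rewrite ?horner0// int_cst// mul0r.
rewrite !big_cons -IH -intZ; last exact: itg_poly.
rewrite -intD; last 2 first.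
- by apply: itgZ; exact: itg_poly.
- exact: itg_poly.
by apply: int_eq => y _; rewrite hornerD hornerZ.
Qed.

(** Division by [nodal] leaves a quotient of size at most [r], which contributes nothing to the
    integral by orthogonality and nothing to the node values. The remainder is its own Lagrange
    interpolant. *)
Let quad1 (q : {poly R}) : (size q <= r.*2)%N ->
  'I(-1, 1, horner q) = 2 * \sum_(j <- s) weight j * q.[G j].
Proof.
move=> qr; have lt11 : -1 <= 1 :> R by lra.
pose m := q %% nodal.
have mr : (size m <= r)%N by rewrite -ltnS -size_nodal ltn_modp.
have qm j : j \in s -> q.[G j] = m.[G j].
  move=> sj; rewrite [in LHS](divp_eq q nodal) hornerD hornerM.
  rewrite {2}/nodal (big_rem j)//= hornerM hornerXsubC subrr mul0r mulr0 add0r//.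
transitivity ('I(-1, 1, horner m)).
  rewrite (int_eq (g := fun y => (q %/ nodal * nodal).[y] + m.[y])); last first.
    by move=> y _; rewrite -hornerD -divp_eq.
  rewrite intD; try exact: itg_poly.
  rewrite nodal_ortho ?add0r// size_divp// size_nodal leq_subLR.
  by rewrite addnn.
rewrite [in LHS](interpolation mr) int_sum_poly// mulr_sumr.
rewrite [LHS]big_seq [RHS]big_seq; apply: eq_bigr => j sj.
by rewrite /weight qm//; field.
Qed.

(** The rule is exact for the square of [lag j]; only the term at [G j] survives, and the integral
    is positive. *)
Let weight_gt0 j : j \in s -> 0 < weight j.
Proof.
move=> sj.
have l0 : lag j != 0.
  apply/eqP => /(congr1 (fun p : {poly R} => p.[G j])).
  by rewrite lag_node// eqxx horner0 => /eqP; rewrite oner_eq0.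
have := @poly_int_gt0 (lag j ^+ 2); rewrite quad1; last first.
  have := size_lag sj => lr.
  have := size_mul_leq (lag j) (lag j); rewrite -expr2 => /leq_trans; apply.
  by rewrite -addnn (leq_trans (leq_pred _))// leq_add.
rewrite (big_rem j)//= big_seq big1 ?addr0; last first.
  move=> i; rewrite (rem_filter _ (iota_uniq _ _)) mem_filter => /andP[/= ij si].
  by rewrite horner_exp lag_node// (negbTE ij) expr0n mulr0.
rewrite horner_exp lag_node// eqxx expr1n mulr1 => H.
have : 0 < 2 * weight j.
  by apply: H; [move=> y _; rewrite horner_exp sqr_ge0|rewrite expf_neq0].
lra.
Qed.

Let quad c d (p : {poly R}) : c <= d -> (size p <= r.*2)%N ->
  'I(c, d, horner p) =
  (d - c) * \sum_(j <- s) weight j * p.[(d + c + (d - c) * G j) / 2].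
Proof.
move=> cd pr; rewrite int_poly_affine// quad1.
  rewrite mulrA; congr (_ * _); first by field.
  apply: eq_bigr => j _; rewrite horner_comp !hornerE; congr (_ * p.[_]).
  by field.
exact: leq_trans (size_comp_affine _ _ _) pr.
Qed.

(** Node values of the derivative are expanded in the Lagrange basis and bounded by Cauchy-Schwarz.
    The sum of inverse weights converts plain squares of node values into weighted ones, and 4 is
    the square of the scaling factor between [[c, d]] and [[-1, 1]]. *)
Let inverse_const : R := 4 * (\sum_(j <- s) (weight j)^-1) *
  \sum_(i <- s) weight i * \sum_(j <- s) (lag j)^`().[G i] ^+ 2.

Let inverse_const_ge0 : 0 <= inverse_const.
Proof.
rewrite /inverse_const !mulr_ge0//.
  by rewrite big_seq sumr_ge0// => j /weight_gt0 h; rewrite invr_ge0 ltW.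
rewrite big_seq sumr_ge0// => j /weight_gt0 h; rewrite mulr_ge0 ?(ltW h)//.
by rewrite sumr_ge0// => i _; exact: sqr_ge0.
Qed.

Let int_poly_sq c d (p : {poly R}) : c <= d -> (size p <= r)%N ->
  'I(c, d, fun t => p.[t] ^+ 2) =
  (d - c) * \sum_(j <- s) weight j * p.[(d + c + (d - c) * G j) / 2] ^+ 2.
Proof.
move=> cd pr; rewrite (int_eq (g := horner (p ^+ 2))) => [|y _]; last by rewrite horner_exp.
rewrite quad//; first by under eq_bigr do rewrite horner_exp.
have := size_mul_leq p p; rewrite -expr2 => /leq_trans; apply.
by rewrite -addnn (leq_trans (leq_pred _))// leq_add.
Qed.

Let inverse_inequality c d (p : {poly R}) : c <= d -> (size p <= r)%N ->
  (d - c) ^+ 2 * 'I(c, d, fun t => p^`().[t] ^+ 2) <=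
  inverse_const * 'I(c, d, fun t => p.[t] ^+ 2).
Proof.
move=> cd pr; have h0 : 0 <= d - c by rewrite subr_ge0.
have [->|p0] := eqVneq p 0.
  rewrite deriv0 (int_eq (g := fun=> 0)) => [|y _]; last by rewrite horner0 expr0n.
  by rewrite int_cst// mul0r mulr0 mulr_ge0// int_ge0// => y _; exact: sqr_ge0.
have dpr : (size p^`() <= r)%N by rewrite (leq_trans _ pr)// ltnW// lt_size_deriv.
rewrite !int_poly_sq//.
set q := p \Po (((c + d) / 2)%:P + ((d - c) / 2) *: 'X).
have aE j : (((c + d) / 2)%:P + ((d - c) / 2) *: 'X).[G j] =
    (d + c + (d - c) * G j) / 2 by rewrite !hornerE; field.
have qE j : p.[(d + c + (d - c) * G j) / 2] = q.[G j].
  by rewrite /q horner_comp aE.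
have dqE j : (d - c) * p^`().[(d + c + (d - c) * G j) / 2] = 2 * q^`().[G j].
  by rewrite /q deriv_affine hornerZ horner_comp aE mulrA; congr (_ * _); field.
have qr : (size q <= r)%N by exact: leq_trans (size_comp_affine _ _ _) pr.
have qS j : q^`().[G j] = \sum_(i <- s) q.[G i] * (lag i)^`().[G j].
  rewrite [in LHS](interpolation qr) raddf_sum horner_sum.
  have E (l : R) (p' : {poly R}) y : (l *: p')^`().[y] = l * p'^`().[y].
    by rewrite derivZ hornerZ.
  by apply: eq_bigr => i _; exact: E.
set B := \sum_(j <- s) weight j * _ ^+ 2.
set B' := \sum_(j <- s) weight j * p.[_] ^+ 2.
have -> : (d - c) ^+ 2 * ((d - c) * B) =
    (d - c) * (4 * \sum_(j <- s) weight j * q^`().[G j] ^+ 2).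
  rewrite mulrCA; congr (_ * _); rewrite !mulr_sumr; apply: eq_bigr => j _.
  have := dqE j; set X := p^`().[_]; move: (q^`().[_]) => Y XY.
  transitivity (weight j * ((d - c) * X) ^+ 2); first by ring.
  by rewrite XY; ring.
rewrite [leRHS]mulrCA ler_wpM2l// /inverse_const -!mulrA ler_wpM2l//.
have q2 : \sum_(j <- s) q.[G j] ^+ 2 <= (\sum_(j <- s) (weight j)^-1) * B'.
  rewrite mulr_sumr [leLHS]big_seq [leRHS]big_seq; apply: ler_sum => j sj.
  have w0 := weight_gt0 sj; rewrite qE mulrA ler_peMl ?sqr_ge0//.
  rewrite -ler_pdivrMr// mul1r (big_rem j)//= lerDl.
  by rewrite big_seq sumr_ge0// => i /mem_rem/weight_gt0 h; rewrite invr_ge0 ltW.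
rewrite mulrCA mulr_suml [leLHS]big_seq [leRHS]big_seq.
apply: ler_sum => j sj; have w0 := weight_gt0 sj.
rewrite -[leRHS]mulrA ler_wpM2l ?(ltW w0)// qS (le_trans (sum_CS _ _ _ _))//.
rewrite mulrC ler_wpM2l//.
by rewrite sumr_ge0// => i _; exact: sqr_ge0.
Qed.

Lemma gauss_rule : exists (A : nat -> R) (K : R),
  [/\ forall j, (1 <= j <= r)%N -> 0 < A j,
      \sum_(j <- s) A j = 1,
      forall c d (p : {poly R}), c <= d -> (size p <= r)%N ->
        'I(c, d, horner p) =
        (d - c) * \sum_(j <- s) A j * p.[(d + c + (d - c) * G j) / 2],
      forall c d (p : {poly R}), c <= d -> (size p <= r)%N ->
        'I(c, d, fun t => p.[t] ^+ 2) =
        (d - c) * \sum_(j <- s) A j * p.[(d + c + (d - c) * G j) / 2] ^+ 2 &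
      0 <= K /\ forall c d (p : {poly R}), c <= d -> (size p <= r)%N ->
        (d - c) ^+ 2 * 'I(c, d, fun t => p^`().[t] ^+ 2) <=
        K * 'I(c, d, fun t => p.[t] ^+ 2)].
Proof.
exists weight, inverse_const; split => //.
- by move=> j; rewrite -mem_s => /weight_gt0.
- have := @quad1 1; rewrite size_poly1 => /(_ _).
  rewrite (int_eq (g := fun=> 1)) => [|y _]; last by rewrite hornerC.
  rewrite int_cst; last lra.
  under eq_bigr do rewrite hornerC mulr1.
  rewrite -addnn (leq_trans hr (leq_addr _ _)) => /(_ isT); lra.
- by move=> c d p cd pr; apply: quad => //; rewrite (leq_trans pr)// -addnn leq_addr.
Qed.

End Gauss.

End Quadrature.

(** * Primal and dual meshes, summation by parts, variational exactness *)

Section FiniteVolume.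
Context {R : realType}.
Local Notation mu := (@lebesgue_measure R).
Local Notation itg c d f := (mu.-integrable `[c, d] (EFin \o f)).
Local Notation "''I' ( c , d , f )" := (\int[mu]_(t in `[c, d]) f t).
Implicit Types (c d m l : R) (f g k u v : R -> R).

Section Mesh.
Variables (r N : nat) (x G : nat -> R) (a b : R).
Hypotheses (hr : (1 <= r)%N) (hG : gauss_points r G) (hx : mesh N x a b).
Local Notation h := (hstep x).
Local Notation g := (gpt r x G).
Implicit Types w : nat -> nat -> R.

Lemma mesh_lt i : (1 <= i <= N)%N -> x i.-1 < x i.
Proof. by case: hx => _ _ _ hx'; case: i => [//|i] /= iN; exact: hx'. Qed.

Lemma mesh_le i j : (i <= j)%N -> (j <= N)%N -> x i <= x j.
Proof.
move=> ij jN; elim: j ij jN => [|j IH]; first by rewrite leqn0 => /eqP ->.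
rewrite leq_eqVlt => /predU1P[-> //|ij] jN.
by rewrite (le_trans (IH ij (ltnW jN)))// ltW// (@mesh_lt j.+1).
Qed.

Lemma mesh_0 : x 0%N = a. Proof. by case: hx. Qed.

Lemma mesh_N : x N = b. Proof. by case: hx. Qed.

Lemma mesh_a i : (i <= N)%N -> a <= x i.
Proof. by move=> iN; rewrite -mesh_0 mesh_le. Qed.

Lemma mesh_b i : (i <= N)%N -> x i <= b.
Proof. by move=> iN; rewrite -mesh_N mesh_le. Qed.

Lemma mesh_N_gt0 : (0 < N)%N. Proof. by case: hx. Qed.

Lemma hstep_gt0 i : (1 <= i <= N)%N -> 0 < h i.
Proof. by move=> iN; rewrite subr_gt0 mesh_lt. Qed.

Lemma sum_hstep : \sum_(1 <= i < N.+1) h i = b - a.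
Proof. by rewrite big_add1 /= telescope_sumr// mesh_N mesh_0. Qed.

Lemma hstep_le i : (1 <= i <= N)%N -> h i <= meshsize N x.
Proof.
move=> iN; rewrite /meshsize; have : i \in index_iota 1 N.+1 by rewrite mem_index_iota ltnS.
elim: (index_iota 1 N.+1) => [//|j s IH]; rewrite inE big_cons => /predU1P[->|/IH h'].
  by rewrite le_max lexx.
by rewrite le_max h' orbT.
Qed.

Lemma gpt_in i j : (1 <= i <= N)%N -> (1 <= j <= r)%N ->
  g i j = (x i + x i.-1 + h i * G j) / 2.
Proof. by move=> iN /andP[_ jr]; rewrite /gpt ltn_eqF// ltnS. Qed.

Lemma gpt_next i : g i r.+1 = g i.+1 1%N.
Proof. by rewrite /gpt eqxx/= ltn_eqF. Qed.

Lemma gpt_itv i j : (1 <= i <= N)%N -> (1 <= j <= r)%N -> x i.-1 < g i j < x i.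
Proof.
move=> iN jr; rewrite (gpt_in iN jr); have /andP[G1 G2] := gauss_point_lt1 hG jr.
have := hstep_gt0 iN; rewrite /hstep; move: (x i) (x i.-1) (G j) G1 G2 => y z t.
by move=> t1 t2 yz; apply/andP; split; nra.
Qed.

Lemma gpt_ab i j : (1 <= i <= N)%N -> (1 <= j <= r)%N -> a < g i j < b.
Proof.
move=> iN jr; have /andP[g1 g2] := gpt_itv iN jr; have /andP[i1 iN'] := iN.
rewrite (le_lt_trans (mesh_a _) g1) ?(leq_trans (leq_pred _))//.
by rewrite (lt_le_trans g2)// mesh_b.
Qed.

(** A dual cell lies inside one element when [j < r] and straddles the node [x i] when [j = r]; the
    last element has no straddling cell. *)
Lemma rdualP i j : (1 <= i <= N)%N -> (1 <= j <= rdual r N i)%N ->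
  (1 <= j <= r)%N /\ ((j < r)%N \/ (j = r /\ (i < N)%N)).
Proof.
move=> /andP[i1 iN]; rewrite /rdual; case: eqVneq => [_|iN'] /andP[j1 jr].
  by rewrite j1; move: jr; rewrite -ltnS prednK// => jr; split; [exact: ltnW|left].
rewrite j1 jr; split=> //; move: jr; rewrite leq_eqVlt => /predU1P[->|]; last by left.
by right; split=> //; rewrite ltn_neqAle iN'.
Qed.

Lemma gpt_le i j : (1 <= i <= N)%N -> (1 <= j <= rdual r N i)%N ->
  a <= g i j /\ g i j <= g i j.+1 /\ g i j.+1 <= b.
Proof.
move=> iN jd; have [jr jcase] := rdualP iN jd.
have /andP[/ltW -> _] := gpt_ab iN jr; split => //.
case: jcase => [jr'|[-> iN']].
  have jr1 : (1 <= j.+1 <= r)%N by [].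
  have /andP[_ /ltW ->] := gpt_ab iN jr1; split => //.
  rewrite !gpt_in//; have [_ Gm] := hG; have /andP[j1 _] := jr.
  have := Gm j j.+1 j1 (leqnn _) jr'; have := hstep_gt0 iN.
  move: (h i) (G j) (G j.+1) (x i + x i.-1) => d t t' y d0 tt'; nra.
rewrite gpt_next; have iN1 : (1 <= i.+1 <= N)%N by [].
have r1 : (1 <= 1 <= r)%N by rewrite hr.
have /andP[_ /ltW ->] := gpt_ab iN1 r1; split => //.
have rr : (1 <= r <= r)%N by rewrite hr leqnn.
have /andP[_ g2] := gpt_itv iN rr; have /andP[g3 _] := gpt_itv iN1 r1.
by rewrite ltW// (lt_trans g2).
Qed.

Lemma sum_by_parts w (q : R -> R) :
  \sum_(1 <= i < N.+1) \sum_(1 <= j < (rdual r N i).+1)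
    w i j * (q (g i j.+1) - q (g i j)) =
  - \sum_(1 <= i < N.+1) \sum_(1 <= j < r.+1) jump r N w i j * q (g i j).
Proof.
(* [T] is set to 0 at [N.+1] by hand: there [wext] would return the unconstrained value [w N r]
   instead of the zero end value. *)
pose T i := if i == N.+1 then 0 else wext r N w i 0 * q (g i 1%N).
apply/eqP; rewrite -subr_eq0 opprK -big_split/=; apply/eqP.
transitivity (\sum_(1 <= i < N.+1) (T i.+1 - T i)).
  apply: eq_big_nat => i /andP[i1]; rewrite ltnS => iN.
  have -> : T i = wext r N w i 0 * q (g i 1%N) by rewrite /T ltn_eqF// ltnS.
  have -> : T i.+1 = wext r N w i r * q (g i r.+1).
    rewrite /T eqSS gpt_next /wext/= (gtn_eqF hr) eqxx andbT eqSS (gtn_eqF i1).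
    by case: eqP => _; rewrite ?mul0r.
  (* In the last element the inner sum is extended to [j = r] at no cost, since [wext] vanishes
     there. *)
  rewrite (_ : \sum_(1 <= j < (rdual r N i).+1) _ =
      \sum_(1 <= j < r.+1) wext r N w i j * (q (g i j.+1) - q (g i j))); last first.
    have E j : (1 <= j <= rdual r N i)%N -> w i j = wext r N w i j.
      move=> jd; have iN1 : (1 <= i <= N)%N by rewrite i1.
      have [/andP[j1 jr] jc] := rdualP iN1 jd; rewrite /wext (gtn_eqF j1).
      by case: jc => [jr'|[-> iN']]; rewrite ?(ltn_eqF jr') ?andbF// (ltn_eqF iN').
    transitivity (\sum_(1 <= j < (rdual r N i).+1) wext r N w i j * (q (g i j.+1) - q (g i j))).
      by apply: eq_big_nat => j /andP[j1]; rewrite ltnS => jd; rewrite E// j1.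
    rewrite /rdual; case: eqVneq => [iN'|//].
    rewrite prednK// [RHS]big_nat_recr//= /wext (gtn_eqF hr) iN' !eqxx/=.
    by rewrite mul0r addr0.
  rewrite -big_split/=; pose f j := wext r N w i j.-1 * q (g i j).
  rewrite -/(f 1%N) -[X in X - _]/(f r.+1); apply: telescope_sumr_eq => //.
  by move=> j /andP[j1 _]; rewrite /f; rewrite /jump/=; ring.
rewrite telescope_sumr// /T eqxx (ltn_eqF (_ : 1 < N.+1)%N) ?ltnS ?mesh_N_gt0//.
by rewrite /wext/= mul0r subr0.
Qed.

Lemma mesh_split f : itg a b f ->
  'I(a, b, f) = \sum_(1 <= i < N.+1) 'I(x i.-1, x i, f).
Proof.
move=> F; rewrite -mesh_N; have : (N <= N)%N by [].
elim: {-2}N => [|n IH] nN; first by rewrite mesh_0 int_xx big_nil.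
rewrite big_nat_recr//= -IH; last exact: ltnW.
apply: int_split; [exact: mesh_a (ltnW nN)|exact: mesh_le|].
by apply: itg_sub F => //; exact: mesh_b.
Qed.

Lemma mesh_itg f : (forall i, (1 <= i <= N)%N -> itg (x i.-1) (x i) f) -> itg a b f.
Proof.
move=> F; rewrite -mesh_N; have : (N <= N)%N by [].
elim: {-2}N => [|n IH] nN.
  rewrite mesh_0; apply: (itg_oo (f := fun=> 0)); last exact: itg_cst.
  by move=> y /andP[y1 y2]; move: (lt_trans y1 y2); rewrite ltxx.
apply: (itg_glue (m := x n)); [exact: mesh_a (ltnW nN)|exact: mesh_le|
  exact: IH (ltnW nN)|exact: (F n.+1)].
Qed.

Lemma mesh_weak_deriv v k : (forall i, (1 <= i <= N)%N -> weak_deriv (x i.-1) (x i) v k) ->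
  weak_deriv a b v k.
Proof.
move=> F; suff H n : (0 < n)%N -> (n <= N)%N -> weak_deriv a (x n) v k.
  by rewrite -mesh_N; exact: H mesh_N_gt0 (leqnn _).
elim: n => [//|[|n] IH _ nN]; first by rewrite -mesh_0; exact: (F 1%N).
apply: (weak_deriv_glue (m := x n.+1)); [exact: mesh_a (ltnW nN)|exact: mesh_le|
  exact: IH (ltnW nN)|exact: (F n.+2)].
Qed.

Lemma int_sum (I : eqType) (s : seq I) (F : I -> R -> R) c d :
  (forall i, i \in s -> itg c d (F i)) ->
  itg c d (fun t => \sum_(i <- s) F i t) /\
  'I(c, d, fun t => \sum_(i <- s) F i t) = \sum_(i <- s) 'I(c, d, F i).
Proof.
elim: s => [|i s IH] H.
  rewrite big_nil (_ : (fun t => \sum_(i <- [::]) F i t) = fun=> 0); last first.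
    by apply/funext => t; rewrite big_nil.
  by split; [exact: itg_cst|rewrite /Rintegral integral0].
have [|H1 H2] := IH; first by move=> j js; apply: H; rewrite inE js orbT.
have Hi : itg c d (F i) by apply: H; rewrite inE eqxx.
rewrite (_ : (fun t => _) = fun t => F i t + \sum_(i <- s) F i t); last first.
  by apply/funext => t; rewrite big_cons.
by split; [exact: itgD|rewrite big_cons intD// H2].
Qed.

Lemma itg_indic c d c' d' f : c <= c' -> d' <= d -> itg c d f ->
  itg c d (fun t => f t * \1_(`[c', d']) t) /\
  'I(c, d, fun t => f t * \1_(`[c', d']) t) = 'I(c', d', f).
Proof.
move=> cc dd F; have E : (fun t => f t * \1_(`[c', d']) t) = f \_ `[c', d'].
  by rewrite patch_indic; apply/funext => t /=.
have S : `[c', d']%classic `<=` `[c, d]%classic by apply: subset_itv; rewrite bnd_simp.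
rewrite E; split.
  rewrite -restrict_EFin; apply/integrable_restrict => //.
  by rewrite setIidr//; exact: itg_sub F.
by rewrite -Rintegral_mkcondr setIidr.
Qed.

Lemma loadE f w : itg a b f ->
  load r N x G f w =
  - \sum_(1 <= i < N.+1) \sum_(1 <= j < r.+1) jump r N w i j * 'I(a, g i j, f).
Proof.
move=> F; rewrite /load -(sum_by_parts w (fun y => 'I(a, y, f))) mesh_0 mesh_N.
have H i j : i \in index_iota 1 N.+1 -> j \in index_iota 1 (rdual r N i).+1 ->
    itg a b (fun t => w i j * (f t * \1_(`[g i j, g i j.+1]) t)) /\
    'I(a, b, fun t => w i j * (f t * \1_(`[g i j, g i j.+1]) t)) =
    w i j * ('I(a, g i j.+1, f) - 'I(a, g i j, f)).
  rewrite !mem_index_iota !ltnS => iN jd.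
  have [g1 [g2 g3]] := gpt_le iN jd.
  have [H1 H2] := itg_indic g1 g3 F; split; first exact: itgZ.
  rewrite intZ// H2 (@int_split _ a (g i j))//; last exact: itg_sub F.
  by rewrite addrAC subrr add0r.
have H' i : i \in index_iota 1 N.+1 ->
    itg a b (fun t => \sum_(1 <= j < (rdual r N i).+1) w i j * (f t * \1_(`[g i j, g i j.+1]) t)) /\
    'I(a, b, fun t => \sum_(1 <= j < (rdual r N i).+1) w i j * (f t * \1_(`[g i j, g i j.+1]) t)) =
    \sum_(1 <= j < (rdual r N i).+1) w i j * ('I(a, g i j.+1, f) - 'I(a, g i j, f)).
  move=> iN; have [|H1 H2] := @int_sum _ (index_iota 1 (rdual r N i).+1)
    (fun j t => w i j * (f t * \1_(`[g i j, g i j.+1]) t)) a b.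
    by move=> j jd; have [] := H i j iN jd.
  split => //; rewrite H2 big_seq [RHS]big_seq; apply: eq_bigr => j jd.
  by have [] := H i j iN jd.
have [|_ H2] := @int_sum _ (index_iota 1 N.+1)
  (fun i t => \sum_(1 <= j < (rdual r N i).+1) w i j * (f t * \1_(`[g i j, g i j.+1]) t)) a b.
  by move=> i iN; have [] := H' i iN.
rewrite (int_eq (g := fun t => \sum_(1 <= i < N.+1) \sum_(1 <= j < (rdual r N i).+1)
    w i j * (f t * \1_(`[g i j, g i j.+1]) t))); last first.
  move=> y _; rewrite /test_fun mulr_sumr; apply: eq_bigr => i _.
  by rewrite mulr_sumr; apply: eq_bigr => j _; rewrite mulrCA.
rewrite H2 big_seq [RHS]big_seq; apply: eq_bigr => i iN.
by have [] := H' i iN.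
Qed.

Lemma a_PE (alpha beta gamma v : R -> R) w :
  itg a b (fun t => beta t * derive1 v t + gamma t * v t) ->
  a_P r N x G alpha beta gamma v w =
  \sum_(1 <= i < N.+1) \sum_(1 <= j < r.+1) jump r N w i j *
    (alpha (g i j) * derive1 v (g i j) -
     'I(a, g i j, fun t => beta t * derive1 v t + gamma t * v t)).
Proof.
pose f t := beta t * derive1 v t + gamma t * v t; rewrite -/f => F; rewrite /a_P -/f.
have -> : \sum_(1 <= i < N.+1) \sum_(1 <= j < (rdual r N i).+1)
    w i j * 'I(g i j, g i j.+1, f) =
  - \sum_(1 <= i < N.+1) \sum_(1 <= j < r.+1) jump r N w i j * 'I(a, g i j, f).
  rewrite -(sum_by_parts w (fun y => 'I(a, y, f))).
  apply: eq_big_nat => i; rewrite ltnS => iN; apply: eq_big_nat => j.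
  rewrite ltnS => jd; have [g1 [g2 g3]] := gpt_le iN jd.
  rewrite [in RHS](@int_split _ a (g i j))//; last exact: itg_sub F.
  by congr (_ * _); rewrite addrAC subrr add0r.
rewrite -sumrB; apply: eq_bigr => i _; rewrite -sumrB; apply: eq_bigr => j _.
by rewrite mulrBr mulrA.
Qed.

Lemma variational_exactness (alpha beta gamma f u : R -> R) w :
  itg a b f -> bvp_solution a b alpha beta gamma f u ->
  (forall i j, (1 <= i <= N)%N -> (1 <= j <= r)%N -> derivable u (g i j) 1) ->
  a_P r N x G alpha beta gamma u w = load r N x G f w.
Proof.
move=> F [_ [q [qE Q]]] Du.
(* A solution need not be piecewise H2, so the integrability is read off the flux equation: the
   integrand is the weak derivative of [q] plus [f]. *)
have Phi : itg a b (fun t => beta t * derive1 u t + gamma t * u t).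
  have := itgD Q.1 F; congr (is_true (_.-integrable _ _)).
  by apply/funext => t /=; rewrite subrK.
rewrite a_PE// loadE//.
(* For a constant function the left side vanishes, so the jumps are orthogonal to constants and the
   integration constant of the flux drops out. *)
have := sum_by_parts w (fun=> q a).
rewrite big1 => [/esym/eqP|i _]; last by rewrite big1// => j _; rewrite subrr mulr0.
rewrite oppr_eq0 => /eqP E0.
rewrite -[RHS]add0r -[X in X - _]E0 -sumrB; apply: eq_big_nat => i; rewrite ltnS => iN.
rewrite -sumrB; apply: eq_big_nat => j; rewrite ltnS => jr.
have gab := gpt_ab iN jr; have /andP[/ltW ag /ltW gb] := gab.
rewrite -qE//; last exact: Du.
have -> : q (g i j) = q a + 'I(a, g i j, fun t =>
    (beta t * derive1 u t + gamma t * u t) - f t) by rewrite Q.2 ?ag.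
rewrite intB; [|exact: itg_sub Phi|exact: itg_sub F].
by rewrite -mulrBr; congr (_ * _); ring.
Qed.

End Mesh.

End FiniteVolume.

(** * The broken norms and boundedness of the form *)

Section BrokenSobolev.
Context {R : realType}.
Local Notation mu := (@lebesgue_measure R).
Local Notation itg c d f := (mu.-integrable `[c, d] (EFin \o f)).
Local Notation "''I' ( c , d , f )" := (\int[mu]_(t in `[c, d]) f t).
Implicit Types (c d m l : R) (f g k u v : R -> R).

Lemma dsum_CS (s t : seq nat) (p q : nat -> nat -> R) :
  (\sum_(i <- s) \sum_(j <- t) p i j * q i j) ^+ 2 <=
  (\sum_(i <- s) \sum_(j <- t) p i j ^+ 2) * (\sum_(i <- s) \sum_(j <- t) q i j ^+ 2).
Proof.
rewrite -(big_allpairs (F := fun z => p z.1 z.2 * q z.1 z.2)).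
rewrite -(big_allpairs (F := fun z => p z.1 z.2 ^+ 2)).
rewrite -(big_allpairs (F := fun z => q z.1 z.2 ^+ 2)).
exact: sum_CS.
Qed.

Lemma dsum_cst (n r : nat) (F : nat -> R) :
  \sum_(1 <= i < n) \sum_(1 <= j < r.+1) F i = r%:R * \sum_(1 <= i < n) F i.
Proof.
by rewrite mulr_sumr; apply: eq_bigr => i _; rewrite sumr_const_nat subn1 mulr_natl.
Qed.

Lemma L2D c d f g : L2 c d f -> L2 c d g -> L2 c d (fun t => f t + g t).
Proof.
move=> F G; have m : measurable_fun `[c, d] (fun t => f t + g t).
  by apply: measurable_funD; [case: F|case: G].
split => //; apply: (@integrable_lty _ _ _ mu) => //.
apply: (@itg_le _ _ _ (fun t => (f t + g t) ^+ 2) (fun t => 2 * (f t ^+ 2 + g t ^+ 2))).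
- exact: measurable_funX.
- move=> y _; rewrite ger0_norm ?sqr_ge0//; have := sqr_ge0 (f y - g y); lra.
- by apply: itgZ; apply: itgD; exact: L2_itg_sq.
Qed.

Lemma L2N c d f : L2 c d f -> L2 c d (fun t => - f t).
Proof.
move=> F; split; first by apply: measurableT_comp => //; case: F.
by under eq_integral do rewrite sqrrN; case: F.
Qed.

Lemma L2_continuous c d f : {within `[c, d], continuous f} -> L2 c d f.
Proof.
move=> cf; have F := itg_continuous cf; split; first exact: itg_meas.
apply: (@integrable_lty _ _ _ mu) => //; exact: (itg_mul_continuous cf F).
Qed.

(** Young's inequality with a free weight. It is linear in the squared norms, so it can be added up
    over elements and over the three terms of the norm before [t] is chosen. *)
Lemma int_sqD (t : R) c d f g : 0 < t -> L2 c d f -> L2 c d g ->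
  'I(c, d, fun y => (f y + g y) ^+ 2) <=
  (1 + t) * 'I(c, d, fun y => f y ^+ 2) + (1 + t^-1) * 'I(c, d, fun y => g y ^+ 2).
Proof.
move=> t0 F G; have F2 := L2_itg_sq F; have G2 := L2_itg_sq G.
have FG2 := L2_itg_sq (L2D F G).
rewrite -!intZ// -intD; [|exact: itgZ|exact: itgZ].
apply: int_le => //; first by apply: itgD; exact: itgZ.
move=> y _; have : 0 <= t * (f y - t^-1 * g y) ^+ 2 by rewrite mulr_ge0 ?sqr_ge0 ?ltW.
have -> : t * (f y - t^-1 * g y) ^+ 2 = t * f y ^+ 2 - 2 * f y * g y + t^-1 * g y ^+ 2.
  by field; rewrite gt_eqF.
lra.
Qed.

(* Optimising over the parameter [t] of [int_sqD] yields Minkowski's inequality. *)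
Lemma sqrt_minkowski (S S1 S2 : R) : 0 <= S1 -> 0 <= S2 ->
  (forall t, 0 < t -> S <= (1 + t) * S1 + (1 + t^-1) * S2) ->
  Num.sqrt S <= Num.sqrt S1 + Num.sqrt S2.
Proof.
move=> S10 S20 H; apply/ler_addgt0Pr => e e0.
(* The optimal [t] is the quotient of the two square roots; the shift by [e / 2] keeps it defined
   and positive when one of them is zero. *)
have p1 : 0 < Num.sqrt S1 + e / 2 by rewrite ltr_wpDl ?sqrtr_ge0 ?divr_gt0.
have p2 : 0 < Num.sqrt S2 + e / 2 by rewrite ltr_wpDl ?sqrtr_ge0 ?divr_gt0.
have E1 : S1 <= (Num.sqrt S1 + e / 2) ^+ 2.
  by rewrite -[leLHS]sqr_sqrtr// ler_sqr ?nnegrE ?sqrtr_ge0 ?(ltW p1)// lerDl; lra.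
have E2 : S2 <= (Num.sqrt S2 + e / 2) ^+ 2.
  by rewrite -[leLHS]sqr_sqrtr// ler_sqr ?nnegrE ?sqrtr_ge0 ?(ltW p2)// lerDl; lra.
move: p1 p2 E1 E2; set y1 := _ + e / 2; set y2 := Num.sqrt S2 + e / 2 => p1 p2 E1 E2.
have -> : Num.sqrt S1 + Num.sqrt S2 + e = y1 + y2 by rewrite /y1 /y2; field.
have t0 : 0 < y2 / y1 by rewrite divr_gt0.
have : S <= (y1 + y2) ^+ 2.
  have -> : (y1 + y2) ^+ 2 = (1 + y2 / y1) * y1 ^+ 2 + (1 + (y2 / y1)^-1) * y2 ^+ 2.
    by field; rewrite !gt_eqF.
  apply: le_trans (H _ t0) _; apply: lerD; apply: ler_wpM2l => //.
    by rewrite addr_ge0// ltW.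
  by rewrite addr_ge0// invr_ge0 ltW.
move=> /ler_wsqrtr/le_trans; apply.
by rewrite sqrtr_sqr ger0_norm// addr_ge0// ltW.
Qed.

Section Norms.
Variables (r N : nat) (x G : nat -> R) (a b : R).
Hypotheses (hr : (1 <= r)%N) (hG : gauss_points r G) (hx : mesh N x a b).
Local Notation h := (hstep x).
Local Notation g := (gpt r x G).
Implicit Types w : nat -> nat -> R.

Let el v i := 'I(x i.-1, x i, fun t => v t ^+ 2)
  + 'I(x i.-1, x i, fun t => derive1 v t ^+ 2)
  + h i ^+ 2 * 'I(x i.-1, x i, fun t => derive1n 2 v t ^+ 2).

Let el_ge0 v i : 0 <= el v i.
Proof.
have I0 f : 0 <= 'I(x i.-1, x i, fun t => f t ^+ 2) by apply: int_ge0 => y _; exact: sqr_ge0.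
by rewrite /el addr_ge0 ?I0// ?addr_ge0 ?I0// mulr_ge0 ?sqr_ge0.
Qed.

Lemma norm_P_ge0 v : 0 <= norm_P N x v. Proof. exact: sqrtr_ge0. Qed.

Lemma norm_P_sqr v : norm_P N x v ^+ 2 = \sum_(1 <= i < N.+1)
  ('I(x i.-1, x i, fun t => v t ^+ 2) + 'I(x i.-1, x i, fun t => derive1 v t ^+ 2)
   + h i ^+ 2 * 'I(x i.-1, x i, fun t => derive1n 2 v t ^+ 2)).
Proof. by rewrite /norm_P sqr_sqrtr// sumr_ge0// => i _; exact: el_ge0. Qed.

Lemma norm_P'_ge0 w : 0 <= norm_P' r N x w. Proof. exact: sqrtr_ge0. Qed.

Lemma norm_P'_sqr w : norm_P' r N x w ^+ 2 =
  \sum_(1 <= i < N.+1) \sum_(1 <= j < r.+1) (h i)^-1 * jump r N w i j ^+ 2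
  + \sum_(1 <= i < N.+1) \sum_(1 <= j < (rdual r N i).+1) h i * w i j ^+ 2.
Proof.
rewrite /norm_P' sqr_sqrtr// addr_ge0//.
  rewrite big_nat_cond sumr_ge0// => i /andP[iN _]; rewrite sumr_ge0// => j _.
  by rewrite mulr_ge0 ?sqr_ge0// invr_ge0 ltW// (hstep_gt0 hx).
rewrite big_nat_cond sumr_ge0// => i /andP[iN _]; rewrite sumr_ge0// => j _.
by rewrite mulr_ge0 ?sqr_ge0// ltW// (hstep_gt0 hx).
Qed.

Lemma H2_broken_data v i : H2_broken N x v -> (1 <= i <= N)%N ->
  exists k k', [/\ weak_deriv (x i.-1) (x i) v k, weak_deriv (x i.-1) (x i) k k'
    & L2 (x i.-1) (x i) k'].
Proof.
by move=> [_ H] iN; have [k [[k' [L K]] V]] := H i iN; exists k, k'.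
Qed.

Lemma H2_brokenD u v : H2_broken N x u -> H2_broken N x v -> H2_broken N x (u \+ v).
Proof.
move=> Hu Hv; split.
  by move=> y; apply: cvgD; [exact: Hu.1|exact: Hv.1].
move=> i iN; have [k [k' [U K L]]] := H2_broken_data Hu iN.
have [l [l' [V K' L']]] := H2_broken_data Hv iN.
exists (fun t => k t + l t); split; last exact: weak_derivD.
by exists (fun t => k' t + l' t); split; [exact: L2D|exact: weak_derivD].
Qed.

Lemma H2_brokenN v : H2_broken N x v -> H2_broken N x (fun t => - v t).
Proof.
move=> Hv; split; first by move=> y; apply: cvgN; exact: Hv.1.
have weak_derivN c d f k : weak_deriv c d f k -> weak_deriv c d (fun t => - f t) (fun t => - k t).
  have E (f' : R -> R) : (fun t => - f' t) = fun t => -1 * f' t by apply/funext => t; rewrite mulN1r.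
  by rewrite !E; exact: weak_derivZ.
move=> i iN; have [k [k' [U K L]]] := H2_broken_data Hv iN.
exists (fun t => - k t); split; last exact: weak_derivN.
by exists (fun t => - k' t); split; [exact: L2N|exact: weak_derivN].
Qed.

Lemma H2_brokenB u v : H2_broken N x u -> H2_broken N x v -> H2_broken N x (u \- v).
Proof. by move=> Hu Hv; apply: (H2_brokenD Hu (H2_brokenN Hv)). Qed.

Lemma norm_PD u v : H2_broken N x u -> H2_broken N x v ->
  norm_P N x (u \+ v) <= norm_P N x u + norm_P N x v.
Proof.
move=> Hu Hv; apply: sqrt_minkowski.
- by apply: sumr_ge0 => i _; exact: el_ge0.
- by apply: sumr_ge0 => i _; exact: el_ge0.
move=> t t0; rewrite !mulr_sumr -big_split; apply: ler_sum_nat => i; rewrite ltnS => iN.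
have xi := mesh_lt hx iN.
have [k [k' [U K L]]] := H2_broken_data Hu iN.
have [l [l' [V K' L']]] := H2_broken_data Hv iN.
(* The element norms are rewritten with weak derivatives, since [derive1n 2] need not be additive at
   every point. *)
have elE f f' f'' : weak_deriv (x i.-1) (x i) f f' -> weak_deriv (x i.-1) (x i) f' f'' ->
    el f i = 'I(x i.-1, x i, fun t => f t ^+ 2) + 'I(x i.-1, x i, fun t => f' t ^+ 2)
      + h i ^+ 2 * 'I(x i.-1, x i, fun t => f'' t ^+ 2).
  by move=> F F'; rewrite /el; have [-> ->] := int_derive1_sq xi F F'.
suff : el (u \+ v) i <= (1 + t) * el u i + (1 + t^-1) * el v i by [].
have := elE (u \+ v) _ _ (weak_derivD U V) (weak_derivD K K').
have := elE u _ _ U K; have := elE v _ _ V K'.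
move: (el (u \+ v) i) (el u i) (el v i) => e1 e2 e3 -> -> ->.
have cont f f' : weak_deriv (x i.-1) (x i) f f' -> L2 (x i.-1) (x i) f.
  by move=> /(weak_deriv_continuous (ltW xi)); exact: L2_continuous.
have := int_sqD t0 (cont _ _ U) (cont _ _ V).
have := int_sqD t0 (cont _ _ K) (cont _ _ K').
have := ler_wpM2l (sqr_ge0 (h i)) (int_sqD t0 L L').
rewrite !mulrDr ![h i ^+ 2 * (_ * _)]mulrCA /=; lra.
Qed.

Lemma norm_P_sub v : H2_broken N x v ->
  let e := [/\ itg a b v, itg a b (derive1 v), itg a b (fun t => v t ^+ 2)
            & itg a b (fun t => derive1 v t ^+ 2)] in
  e /\ 'I(a, b, fun t => v t ^+ 2) + 'I(a, b, fun t => derive1 v t ^+ 2) <= norm_P N x v ^+ 2.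
Proof.
move=> Hv.
have H i : (1 <= i <= N)%N -> [/\ itg (x i.-1) (x i) v, itg (x i.-1) (x i) (derive1 v),
    itg (x i.-1) (x i) (fun t => v t ^+ 2) & itg (x i.-1) (x i) (fun t => derive1 v t ^+ 2)].
  move=> iN; have xi := mesh_lt hx iN.
  have [k [k' [U K L]]] := H2_broken_data Hv iN.
  have cv := weak_deriv_continuous (ltW xi) U; have ck := weak_deriv_continuous (ltW xi) K.
  have E y : x i.-1 < y < x i -> k y = derive1 v y.
    by move=> yi; have [] := weak_deriv_derive1 xi U ck yi.
  split.
  - exact: itg_continuous.
  - exact: itg_oo E U.1.
  - exact: (itg_mul_continuous cv (itg_continuous cv)).
  - apply: (itg_oo (f := fun t => k t ^+ 2)) => [y /E -> //|].
    exact: (itg_mul_continuous ck U.1).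
have e : [/\ itg a b v, itg a b (derive1 v), itg a b (fun t => v t ^+ 2)
            & itg a b (fun t => derive1 v t ^+ 2)].
  by split; apply: (mesh_itg hx) => i iN; have [] := H i iN.
split=> //; case: e => _ _ e1 e2.
rewrite norm_P_sqr (mesh_split hx e1) (mesh_split hx e2) -big_split.
apply: ler_sum_nat => i _; rewrite lerDl mulr_ge0 ?sqr_ge0// int_ge0// => y _.
exact: sqr_ge0.
Qed.

(** Point values of v' are not controlled by the L2 norm of v' alone; the term with [h i ^+ 2] and
    v'' in the norm is what pays for them. The factor [r] counts the Gauss points of an element. *)
Lemma gauss_values_le v : H2_broken N x v ->
  \sum_(1 <= i < N.+1) \sum_(1 <= j < r.+1) h i * derive1 v (g i j) ^+ 2 <=
  r%:R * (2 * norm_P N x v ^+ 2).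
Proof.
move=> Hv; rewrite norm_P_sqr mulr_sumr -dsum_cst; apply: ler_sum_nat => i.
rewrite ltnS => iN; apply: ler_sum_nat => j; rewrite ltnS => jr.
have xi := mesh_lt hx iN; have [k [k' [U K L]]] := H2_broken_data Hv iN.
have gij := gpt_itv hG hx iN jr.
have [_ ->] := weak_deriv_derive1 xi U (weak_deriv_continuous (ltW xi) K) gij.
have [-> ->] := int_derive1_sq xi U K.
have /andP[/ltW g1 /ltW g2] := gij.
apply: le_trans (weak_deriv_point_bound xi K L _) _; first by rewrite g1.
rewrite ler_wpM2l// lerD2r lerDr int_ge0// => y _; exact: sqr_ge0.
Qed.

Lemma H2_broken_derivable v i j : H2_broken N x v -> (1 <= i <= N)%N -> (1 <= j <= r)%N ->
  derivable v (g i j) 1.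
Proof.
move=> Hv iN jr; have xi := mesh_lt hx iN; have [k [k' [U K L]]] := H2_broken_data Hv iN.
by have [] := weak_deriv_derive1 xi U (weak_deriv_continuous (ltW xi) K) (gpt_itv hG hx iN jr).
Qed.

Section Bounded.
Variables (alpha beta gamma : R -> R) (L : R).
Hypotheses (L0 : 0 <= L) (hbeta : ess_bounded a b L beta) (hgamma : ess_bounded a b L gamma).
Local Notation phi v := (fun t => beta t * derive1 v t + gamma t * v t).

Lemma phi_itg c d v : a <= c -> d <= b -> itg a b v -> itg a b (derive1 v) ->
  itg c d (phi v) /\
  'I(c, d, fun t => `|phi v t|) <=
  L * ('I(c, d, fun t => `|derive1 v t|) + 'I(c, d, fun t => `|v t|)).
Proof.
move=> ac db V V'.
have sub (m : R -> R) : ess_bounded a b L m -> ess_bounded c d L m.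
  move=> [mm mL]; split.
    apply: measurable_funS mm => //; apply: subset_itv; rewrite bnd_simp//.
  refine (ae_imp _ mL) => y /= my /andP[cy yd]; apply: my.
  by rewrite (le_trans ac) ?(le_trans yd).
have {}V := itg_sub ac db V; have {}V' := itg_sub ac db V'.
have [B1 B2] := itg_ess_bounded L0 (sub _ hbeta) V'.
have [G1 G2] := itg_ess_bounded L0 (sub _ hgamma) V.
have P := itgD B1 G1; split => //.
rewrite mulrDr (le_trans _ (lerD B2 G2))// -intD; [|exact: itg_norm|exact: itg_norm].
apply: int_le; [exact: itg_norm|by apply: itgD; exact: itg_norm|].
by move=> y _; exact: ler_normD.
Qed.

Lemma a_P_bounded v w : (forall y, a <= y <= b -> `|alpha y| <= L) -> H2_broken N x v ->
  `|a_P r N x G alpha beta gamma v w| <=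
  L * Num.sqrt (4 * r%:R * (1 + (b - a) ^+ 2)) * norm_P N x v * norm_P' r N x w.
Proof.
move=> halpha Hv; have [[V V' V2 V'2] n] := norm_P_sub Hv.
have ab : a < b by rewrite -(mesh_0 hx) -(mesh_N hx) (lt_le_trans (@mesh_lt _ _ _ _ _ hx 1%N _)) ?(mesh_le hx) ?(mesh_N_gt0 hx).
have [P P1] := phi_itg (lexx a) (lexx b) V V'.
rewrite (a_PE hr hG hx)//.
set E := fun i j => alpha (g i j) * derive1 v (g i j) - 'I(a, g i j, phi v).
set n2 := norm_P N x v ^+ 2 in n.
(* The primitive is at most the L1 norm of its integrand over the whole interval, and Cauchy-Schwarz
   brings in the factor [b - a]. *)
have Phi i j : (1 <= i <= N)%N -> (1 <= j <= r)%N ->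
    'I(a, g i j, phi v) ^+ 2 <= 2 * L ^+ 2 * (b - a) * n2.
  move=> iN jr; have /andP[/ltW ag /ltW gb] := gpt_ab hG hx iN jr.
  have h1 : `|'I(a, g i j, phi v)| <= L * ('I(a, b, fun t => `|derive1 v t|) + 'I(a, b, fun t => `|v t|)).
    apply: le_trans P1; apply: le_trans (int_abs (itg_sub (lexx _) gb P)) _.
    by apply: int_sub_ge0 => //; exact: itg_norm.
  have h2 := int_sq ab V V2; have h3 := int_sq ab V' V'2.
  rewrite -(real_normK (num_real 'I(a, g i j, phi v))).
  move: h1 h2 h3 n; set p := `|_|; set A := 'I(a, b, fun t => `|derive1 v t|).
  set B := 'I(a, b, fun t => `|v t|); set A2 := 'I(a, b, fun t => derive1 v t ^+ 2).
  set B2 := 'I(a, b, fun t => v t ^+ 2) => h1 h2 h3 n.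
  have A0 : 0 <= A by exact: int_ge0.
  have B0 : 0 <= B by exact: int_ge0.
  have h4 : p ^+ 2 <= (L * (A + B)) ^+ 2.
    have p0 : 0 <= p by exact: normr_ge0.
    by rewrite ler_sqr ?nnegrE// mulr_ge0// addr_ge0.
  have h5 : (A + B) ^+ 2 <= 2 * ((b - a) * n2).
    have h6 : (b - a) * (B2 + A2) <= (b - a) * n2 by rewrite ler_wpM2l// subr_ge0 ltW.
    have := sqr_ge0 (A - B); lra.
  have := ler_wpM2l (sqr_ge0 L) h5; rewrite exprMn in h4; lra.
(* The 4 is a 2 from squaring a difference times a 2 from the trace estimate or from [Phi]. The
   second [b - a] in the square is the sum of the steps. *)
have hE : \sum_(1 <= i < N.+1) \sum_(1 <= j < r.+1) h i * E i j ^+ 2 <=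
    L ^+ 2 * (4 * r%:R * (1 + (b - a) ^+ 2)) * n2.
  apply: (@le_trans _ _ (\sum_(1 <= i < N.+1) \sum_(1 <= j < r.+1)
     (2 * L ^+ 2 * (h i * derive1 v (g i j) ^+ 2) + 4 * L ^+ 2 * (b - a) * n2 * h i))).
    apply: ler_sum_nat => i; rewrite ltnS => iN; apply: ler_sum_nat => j; rewrite ltnS => jr.
    have := Phi i j iN jr; have h0 := hstep_gt0 hx iN.
    have /andP[/ltW ag /ltW gb] := gpt_ab hG hx iN jr.
    have := halpha (g i j); rewrite ag gb => /(_ isT).
    rewrite /E; move: (alpha (g i j)) (derive1 v (g i j)) ('I(a, g i j, phi v)) => y z p pL yL.
    have y2 : y ^+ 2 <= L ^+ 2.
      by rewrite -(real_normK (num_real y)) ler_sqr ?nnegrE.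
    have h1 : (y * z - p) ^+ 2 <= 2 * (y ^+ 2 * z ^+ 2) + 2 * p ^+ 2.
      have := sqr_ge0 (y * z + p); lra.
    have h2 := ler_wpM2r (sqr_ge0 z) y2.
    have h3 : (y * z - p) ^+ 2 <= 2 * L ^+ 2 * z ^+ 2 + 4 * L ^+ 2 * (b - a) * n2 by lra.
    have := ler_wpM2l (ltW h0) h3; lra.
  under eq_bigr do rewrite big_split/= -mulr_sumr.
  rewrite big_split/= -mulr_sumr dsum_cst -mulr_sumr (sum_hstep hx).
  have := ler_wpM2l (sqr_ge0 L) (gauss_values_le Hv); rewrite -/n2; lra.
rewrite -ler_sqr ?nnegrE// ?mulr_ge0 ?sqrtr_ge0 ?norm_P_ge0 ?norm_P'_ge0//.
rewrite real_normK ?num_real// !exprMn sqr_sqrtr; last first.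
  by rewrite !mulr_ge0// addr_ge0// sqr_ge0.
rewrite -/n2 [leRHS]mulrC.
(* The weight [h i] is split into square roots so that the first Cauchy-Schwarz factor is the jump
   part of [norm_P'] and the second is [hE]. *)
have -> : \sum_(1 <= i < N.+1) \sum_(1 <= j < r.+1) jump r N w i j * E i j =
    \sum_(1 <= i < N.+1) \sum_(1 <= j < r.+1)
      (jump r N w i j * (Num.sqrt (h i))^-1) * (Num.sqrt (h i) * E i j).
  apply: eq_big_nat => i; rewrite ltnS => iN; apply: eq_bigr => j _.
  by rewrite mulrA divfK// gt_eqF// sqrtr_gt0 (hstep_gt0 hx).
apply: le_trans (dsum_CS _ _ _ _) _; apply: ler_pM.
- by apply: sumr_ge0 => i _; apply: sumr_ge0 => j _; exact: sqr_ge0.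
- by apply: sumr_ge0 => i _; apply: sumr_ge0 => j _; exact: sqr_ge0.
- rewrite norm_P'_sqr -[leLHS]addr0 lerD//.
    rewrite le_eqVlt; apply/orP; left; apply/eqP.
    apply: eq_big_nat => i; rewrite ltnS => iN; apply: eq_bigr => j _.
    by rewrite exprMn exprVn sqr_sqrtr ?(ltW (hstep_gt0 hx iN))// mulrC.
  rewrite big_nat_cond sumr_ge0// => i /andP[iN _]; rewrite sumr_ge0// => j _.
  by rewrite mulr_ge0 ?sqr_ge0// ltW// (hstep_gt0 hx).
- apply: le_trans hE; rewrite le_eqVlt; apply/orP; left; apply/eqP.
  apply: eq_big_nat => i; rewrite ltnS => iN; apply: eq_bigr => j _.
  by rewrite exprMn sqr_sqrtr// (ltW (hstep_gt0 hx iN)).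
Qed.

End Bounded.

End Norms.

End BrokenSobolev.

(** * Trial functions and their dual test functions *)

Section InfSupCondition.
Context {R : realType}.
Local Notation mu := (@lebesgue_measure R).
Local Notation itg c d f := (mu.-integrable `[c, d] (EFin \o f)).
Local Notation "''I' ( c , d , f )" := (\int[mu]_(t in `[c, d]) f t).
Implicit Types (c d m l : R) (f g k u v : R -> R).

Section InfSup.
Variables (r N : nat) (x G : nat -> R) (a b : R).
Hypotheses (hr : (1 <= r)%N) (hG : gauss_points r G) (hx : mesh N x a b).
Local Notation h := (hstep x).
Local Notation g := (gpt r x G).
Implicit Types w : nat -> nat -> R.

Let ab : a < b.
Proof.
rewrite -(mesh_0 hx) -(mesh_N hx) (lt_le_trans (@mesh_lt _ _ _ _ _ hx 1%N _))//.
- by rewrite (mesh_N_gt0 hx).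
- by rewrite (mesh_le hx) ?(mesh_N_gt0 hx).
Qed.

Lemma trial_poly v i : trial_space r N x v -> (1 <= i <= N)%N ->
  exists p : {poly R}, (size p <= r)%N /\
    [/\ weak_deriv (x i.-1) (x i) v (horner p),
        weak_deriv (x i.-1) (x i) (horner p) (horner p^`())
      & forall y, x i.-1 < y < x i -> p.[y] = derive1 v y].
Proof.
move=> [_ H _ _] iN; have [p [pr vp]] := H i iN; have xi := mesh_lt hx iN.
have V : weak_deriv (x i.-1) (x i) v (horner p^`()).
  by apply: (weak_deriv_ext (v := horner p)) (ltW xi) (weak_deriv_poly p (ltW xi)) => y /vp ->.
exists p^`(); split.
  have [->|p0] := eqVneq p 0; first by rewrite deriv0 size_poly0.
  by rewrite -ltnS (leq_trans (lt_size_deriv p0)).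
split => //; first exact: weak_deriv_poly (ltW xi).
move=> y yi; have [|_ ->//] := weak_deriv_derive1 xi V _ yi.
by apply: continuous_subspaceT; exact: continuous_horner.
Qed.

Lemma trial_space_H2_broken v : trial_space r N x v -> H2_broken N x v.
Proof.
move=> Tv; split; first by case: Tv.
move=> i iN; have [p [_ [V P _]]] := trial_poly Tv iN.
exists (horner p); split => //; exists (horner p^`()); split => //.
by apply: L2_continuous; apply: continuous_subspaceT; exact: continuous_horner.
Qed.

Lemma trial_weak_deriv v : trial_space r N x v -> weak_deriv a b v (derive1 v).
Proof.
move=> Tv; apply: (mesh_weak_deriv hx) => i iN; have [p [_ [V _ pE]]] := trial_poly Tv iN.
exact: weak_deriv_oo pE V.
Qed.

Lemma trialB u v : trial_space r N x u -> trial_space r N x v ->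
  trial_space r N x (u \- v).
Proof.
move=> [cu pu u0 uN] [cv pv v0 vN]; split.
- by move=> y; apply: cvgB; [exact: cu|exact: cv].
- move=> i iN; have [p [ps pE]] := pu i iN; have [q [qs qE]] := pv i iN.
  exists (p - q); split; last by move=> y yi; rewrite hornerD hornerN -pE// -qE.
  by rewrite (leq_trans (size_polyD _ _))// geq_max size_polyN ps.
- by rewrite /= u0 v0 subrr.
- by rewrite /= uN vN subrr.
Qed.

Variables (A : nat -> R) (K : R).
Hypothesis A_gt0 : forall j, (1 <= j <= r)%N -> 0 < A j.
Hypothesis A_sum : \sum_(1 <= j < r.+1) A j = 1.
Hypothesis A_int : forall c d (p : {poly R}), c <= d -> (size p <= r)%N ->
  'I(c, d, horner p) =
  (d - c) * \sum_(1 <= j < r.+1) A j * p.[(d + c + (d - c) * G j) / 2].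
Hypothesis A_sqr : forall c d (p : {poly R}), c <= d -> (size p <= r)%N ->
  'I(c, d, fun t => p.[t] ^+ 2) =
  (d - c) * \sum_(1 <= j < r.+1) A j * p.[(d + c + (d - c) * G j) / 2] ^+ 2.
Hypothesis K_ge0 : 0 <= K.
Hypothesis K_inv : forall c d (p : {poly R}), c <= d -> (size p <= r)%N ->
  (d - c) ^+ 2 * 'I(c, d, fun t => p^`().[t] ^+ 2) <= K * 'I(c, d, fun t => p.[t] ^+ 2).

Let A_ge0 j : (1 <= j <= r)%N -> 0 <= A j. Proof. by move=> /A_gt0/ltW. Qed.

Let A_le1 j : (1 <= j <= r)%N -> A j <= 1.
Proof.
move=> jr; rewrite -A_sum (big_rem j) ?mem_index_iota ?ltnS//= lerDl.
rewrite big_seq sumr_ge0// => i /mem_rem; rewrite mem_index_iota ltnS; exact: A_ge0.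
Qed.

Variable v : R -> R.
Hypothesis Tv : trial_space r N x v.
Let D i j := derive1 v (g i j).
Let c i j := h i * A j * D i j.
Let S := 'I(a, b, fun t => derive1 v t ^+ 2).

Let trial_elt i : (1 <= i <= N)%N ->
  [/\ 'I(x i.-1, x i, derive1 v) = \sum_(1 <= j < r.+1) c i j,
      'I(x i.-1, x i, fun t => derive1 v t ^+ 2) =
        \sum_(1 <= j < r.+1) h i * A j * D i j ^+ 2
    & h i ^+ 2 * 'I(x i.-1, x i, fun t => derive1n 2 v t ^+ 2) <=
      K * 'I(x i.-1, x i, fun t => derive1 v t ^+ 2)].
Proof.
move=> iN; have xi := mesh_lt hx iN.
have [p [pr [V P pE]]] := trial_poly Tv iN.
have DE j : (1 <= j <= r)%N -> p.[(x i + x i.-1 + (x i - x i.-1) * G j) / 2] = D i j.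
  move=> jr; have gi := gpt_itv hG hx iN jr.
  by rewrite /D -(pE _ gi) (gpt_in x G iN jr).
have [E1 E2] := int_derive1_sq xi V P; rewrite E1 E2; split.
- rewrite -(int_oo pE V.1) A_int ?(ltW xi)// mulr_sumr.
  by apply: eq_big_nat => j; rewrite ltnS => jr; rewrite DE// mulrA.
- rewrite A_sqr ?(ltW xi)// mulr_sumr.
  by apply: eq_big_nat => j; rewrite ltnS => jr; rewrite DE// mulrA.
- by apply: K_inv => //; exact: ltW.
Qed.

Let Hv := trial_space_H2_broken Tv.
Let v_a : v a = 0. Proof. by case: Tv => _ _ + _; rewrite (mesh_0 hx). Qed.

Let v_b : v b = 0. Proof. by case: Tv => _ _ _; rewrite (mesh_N hx). Qed.

Let sum_D2 : \sum_(1 <= i < N.+1) \sum_(1 <= j < r.+1) h i * A j * D i j ^+ 2 = S.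
Proof.
have [[_ _ _ V2] _] := norm_P_sub hx Hv.
rewrite /S (mesh_split hx V2); apply: eq_big_nat => i; rewrite ltnS => iN.
by have [_ -> _] := trial_elt iN.
Qed.

Let S_ge0 : 0 <= S. Proof. by apply: int_ge0 => y _; exact: sqr_ge0. Qed.

Let bS_ge0 : 0 <= (b - a) * S.
Proof. by rewrite mulr_ge0 ?S_ge0// subr_ge0 ltW. Qed.

Let int_dv : 'I(a, b, fun t => `|derive1 v t|) ^+ 2 <= (b - a) * S.
Proof. by have [[_ V _ V2] _] := norm_P_sub hx Hv; exact: int_sq. Qed.

(** Pointwise Poincare inequality from [v a = 0]. *)
Let v_bound y : a <= y <= b -> v y ^+ 2 <= (b - a) * S.
Proof.
move=> yab; apply: le_trans int_dv.
have := weak_deriv_bound (trial_weak_deriv Tv) yab (_ : a <= a <= b); rewrite lexx (ltW ab) v_a subr0 => /(_ isT) le.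
by rewrite -(real_normK (num_real (v y))) ler_sqr ?nnegrE// int_ge0.
Qed.

Let T := \sum_(1 <= i < N.+1) \sum_(1 <= j < r.+1) `|c i j|.

(** Discrete counterpart of [int_dv]: the weights [h i * A j] add up to [b - a], and the weighted
    squares of v' add up to exactly [S]. *)
Let sum_abs_c : T ^+ 2 <= (b - a) * S.
Proof.
have hA i j : (1 <= i <= N)%N -> (1 <= j <= r)%N -> 0 <= h i * A j.
  by move=> iN jr; rewrite mulr_ge0 ?A_ge0// ltW// (hstep_gt0 hx).
have -> : T = \sum_(1 <= i < N.+1) \sum_(1 <= j < r.+1)
    Num.sqrt (h i * A j) * (Num.sqrt (h i * A j) * `|D i j|).
  apply: eq_big_nat => i; rewrite ltnS => iN; apply: eq_big_nat => j; rewrite ltnS => jr.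
  by rewrite mulrA -expr2 sqr_sqrtr ?hA// /c normrM ger0_norm ?hA.
apply: le_trans (dsum_CS _ _ _ _) _; rewrite le_eqVlt; apply/orP; left; apply/eqP.
congr (_ * _).
  rewrite -(sum_hstep hx); apply: eq_big_nat => i; rewrite ltnS => iN.
  rewrite -[RHS]mulr1 -A_sum mulr_sumr; apply: eq_big_nat => j; rewrite ltnS => jr.
  by rewrite sqr_sqrtr ?hA.
rewrite -sum_D2; apply: eq_big_nat => i; rewrite ltnS => iN.
apply: eq_big_nat => j; rewrite ltnS => jr.
by rewrite exprMn sqr_sqrtr ?hA// real_normK ?num_real.
Qed.

(** On the trial space [S] controls all three terms: the Poincare inequality handles v and the
    inverse inequality handles v''. *)
Lemma trial_norm_P : norm_P N x v ^+ 2 <= ((b - a) ^+ 2 + 1 + K) * S.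
Proof.
have [[_ _ V1 V2] _] := norm_P_sub hx Hv.
have -> : norm_P N x v ^+ 2 = 'I(a, b, fun t => v t ^+ 2) + S +
    \sum_(1 <= i < N.+1) h i ^+ 2 * 'I(x i.-1, x i, fun t => derive1n 2 v t ^+ 2).
  have split3 (s : seq nat) (F1 F2 F3 : nat -> R) :
      \sum_(i <- s) (F1 i + F2 i + F3 i) =
      \sum_(i <- s) F1 i + \sum_(i <- s) F2 i + \sum_(i <- s) F3 i.
    by rewrite !big_split.
  rewrite norm_P_sqr /S [in RHS](mesh_split hx V1) [in RHS](mesh_split hx V2).
  exact: split3.
have I1 : 'I(a, b, fun t => v t ^+ 2) <= (b - a) ^+ 2 * S.
  have -> : (b - a) ^+ 2 * S = 'I(a, b, fun=> (b - a) * S).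
    by rewrite (int_cst _ (ltW ab)); ring.
  by apply: int_le => //; exact: itg_cst.
have I2 : \sum_(1 <= i < N.+1) h i ^+ 2 * 'I(x i.-1, x i, fun t => derive1n 2 v t ^+ 2)
    <= K * S.
  rewrite /S (mesh_split hx V2) mulr_sumr; apply: ler_sum_nat => i; rewrite ltnS => iN.
  by have [] := trial_elt iN.
lra.
Qed.

(* The test function paired with [v]: its jumps are the Gauss-weighted values
   of [v'], so that by exactness of the quadrature it agrees with [v] at the
   mesh nodes. *)
Definition dual_test i j : R :=
  \sum_(1 <= m < i) \sum_(1 <= l < r.+1) c m l + \sum_(1 <= l < j.+1) c i l.

(** [wext] forces this coefficient to be 0. The definition respects that because the sum of all
    jumps is the quadrature of v', hence the increment of [v] over the interval. *)
Let dual_test_total : dual_test N r = 0.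
Proof.
rewrite /dual_test -big_nat_recr ?(mesh_N_gt0 hx)//=.
have V := trial_weak_deriv Tv.
have <- : 'I(a, b, derive1 v) = \sum_(1 <= m < N.+1) \sum_(1 <= l < r.+1) c m l.
  rewrite (mesh_split hx V.1); apply: eq_big_nat => i; rewrite ltnS => iN.
  by have [] := trial_elt iN.
by have := weak_deriv_eq V (lexx a) (ltW ab) (lexx b); rewrite v_a v_b add0r => <-.
Qed.

Let wext_dual i j : (1 <= i <= N)%N -> (j <= r)%N ->
  wext r N dual_test i j = dual_test i j.
Proof.
move=> /andP[i1 iN] jr; rewrite /wext; case: eqVneq => [->|j0].
  case: eqVneq => [->|ni1]; first by rewrite /dual_test !big_geq ?addr0.
  case: i i1 iN ni1 => [|[|i]]// _ iN _.
  by rewrite /dual_test/= -big_nat_recr//= [X in _ + X]big_geq ?addr0.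
by case: eqVneq => [->|]//=; case: eqVneq => [->|]//=; rewrite dual_test_total.
Qed.

Let jump_dual i j : (1 <= i <= N)%N -> (1 <= j <= r)%N ->
  jump r N dual_test i j = c i j.
Proof.
move=> iN /andP[j1 jr]; rewrite /jump !wext_dual//; last first.
  exact: leq_trans (leq_pred _) jr.
rewrite /dual_test (prednK j1) big_nat_recr//= opprD addrACA subrr add0r.
by rewrite addrAC subrr add0r.
Qed.

Let dual_bound i j : (1 <= i <= N)%N -> (j <= r)%N ->
  dual_test i j ^+ 2 <= (b - a) * S.
Proof.
move=> /andP[i1 iN] jr; apply: le_trans sum_abs_c.
have T0 : 0 <= T by rewrite /T; do 2 apply: sumr_ge0 => ? _.
rewrite -(real_normK (num_real (dual_test i j))) ler_sqr ?nnegrE//.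
rewrite /T (big_cat_nat (n := i))//=; last exact: leqW.
rewrite (le_trans (ler_normD _ _))// lerD//.
  rewrite (le_trans (ler_norm_sum _ _ _))//; apply: ler_sum => m _.
  exact: ler_norm_sum.
rewrite big_nat_recl//= -[leLHS]addr0 lerD//; last first.
  by apply: sumr_ge0 => m _; apply: sumr_ge0.
rewrite (le_trans (ler_norm_sum _ _ _))// [leRHS](big_cat_nat (n := j.+1))//= lerDl.
exact: sumr_ge0.
Qed.

(** The jump part is the quadrature of v'^2 with an extra factor [A j <= 1]. In the other part each
    coefficient is a partial sum of the [c i j], so its square is at most [(b - a) * S]. *)
Lemma dual_norm_P' : norm_P' r N x dual_test ^+ 2 <= (1 + r%:R * (b - a) ^+ 2) * S.
Proof.
rewrite (norm_P'_sqr r hx) mulrDl mul1r lerD//.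
  rewrite -sum_D2; apply: ler_sum_nat => i; rewrite ltnS => iN.
  apply: ler_sum_nat => j; rewrite ltnS => jr; rewrite jump_dual//.
  have h0 := hstep_gt0 hx iN.
  have -> : (h i)^-1 * c i j ^+ 2 = A j * (h i * A j * D i j ^+ 2).
    by rewrite /c; field; rewrite gt_eqF.
  apply: ler_piMl; last exact: A_le1.
  by rewrite mulr_ge0 ?sqr_ge0// mulr_ge0 ?A_ge0// ltW.
apply: (@le_trans _ _ (\sum_(1 <= i < N.+1) \sum_(1 <= j < r.+1) h i * ((b - a) * S))).
  apply: ler_sum_nat => i; rewrite ltnS => iN; have h0 := hstep_gt0 hx iN.
  have dr : (rdual r N i <= r)%N by rewrite /rdual; case: ifP => // _; exact: leq_pred.
  rewrite [leRHS](big_cat_nat (n := (rdual r N i).+1))//= -[leLHS]addr0 lerD//; last first.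
    by apply: sumr_ge0 => j _; rewrite mulr_ge0 ?bS_ge0 ?(ltW h0).
  apply: ler_sum_nat => j; rewrite ltnS => /andP[_ jr].
  by rewrite ler_wpM2l ?(ltW h0)// dual_bound// (leq_trans jr).
rewrite dsum_cst -mulr_suml (sum_hstep hx); lra.
Qed.

(** * Coercivity on the pair of trial and test function *)

Section Coercive.
Variables (alpha beta gamma : R -> R) (alpha0 kappa L : R).
Hypotheses (alpha0_gt0 : 0 < alpha0) (kappa_gt0 : 0 < kappa).
Hypothesis hc : coefficients a b alpha beta gamma alpha0 kappa L.
Let phi t := beta t * derive1 v t + gamma t * v t.
Let Phi y := 'I(a, y, phi).

Let L_ge0 : 0 <= L.
Proof.
have [_ /(_ a) H _] := hc; rewrite lexx (ltW ab) in H.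
have /andP[H1 H2] := H isT.
by rewrite (le_trans _ H2)// (le_trans _ H1)// ltW.
Qed.

Let hbeta : ess_bounded a b L beta. Proof. by case: hc => -[]. Qed.

Let hgamma : ess_bounded a b L gamma. Proof. by case: hc => -[]. Qed.

Let phi_ab : itg a b phi.
Proof.
have [[V V' _ _] _] := norm_P_sub hx Hv.
by have [] := phi_itg L_ge0 hbeta hgamma (lexx a) (lexx b) V V'.
Qed.

Let Phi_wd : weak_deriv a b Phi phi. Proof. exact: weak_deriv_primitive (ltW ab) phi_ab. Qed.

Let energy : 0 <= - 'I(a, b, fun t => derive1 v t * Phi t).
Proof.
have V := trial_weak_deriv Tv; have cv := weak_deriv_continuous (ltW ab) V.
have iv := weak_deriv_itg (ltW ab) V.
have [_ _ [dbeta [B hB]]] := hc.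
have cB := weak_deriv_continuous (ltW ab) B.
have P1 := weak_deriv_int_by_parts (ltW ab) V Phi_wd.
have VV := weak_derivM (ltW ab) V V.
have P2 := weak_deriv_int_by_parts (ltW ab) B VV.
rewrite v_a v_b !(mul0r, mulr0) subrr in P1; rewrite v_a v_b !(mul0r, mulr0) subrr in P2.
have i1 : itg a b (fun t => v t * phi t) by apply: itg_mul_continuous cv phi_ab.
have i2 : itg a b (fun t => derive1 v t * Phi t).
  rewrite (_ : (fun t => _) = fun t => Phi t * derive1 v t); last first.
    by apply/funext => t; rewrite mulrC.
  by apply: itg_mul_continuous V.1; exact: weak_deriv_continuous (ltW ab) Phi_wd.
have i3 := (weak_derivM (ltW ab) B VV).1.
rewrite intD// in P1.
(* [P1] moves the derivative onto [Phi]. By [P2] the subtracted integral is zero; half of it trades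
   the term with beta v v' for -beta' v^2 / 2. *)
have -> : - 'I(a, b, fun t => derive1 v t * Phi t) =
    'I(a, b, fun t => v t * phi t) - 2^-1 * 'I(a, b, fun t =>
      beta t * (v t * derive1 v t + derive1 v t * v t) + dbeta t * (v t * v t)) by lra.
rewrite -intZ// -intB//; last exact: itgZ.
apply: int_ae_ge0; first by apply: itgB => //; exact: itgZ.
refine (ae_imp _ hB) => y /= Hy yab.
have -> : v y * phi y - 2^-1 *
    (beta y * (v y * derive1 v y + derive1 v y * v y) + dbeta y * (v y * v y)) =
    (gamma y - dbeta y / 2) * v y ^+ 2 by rewrite /phi; field.
by rewrite mulr_ge0 ?sqr_ge0// (le_trans (ltW kappa_gt0))// Hy.
Qed.

Let osc i y : (1 <= i <= N)%N -> x i.-1 <= y <= x i ->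
  `|Phi y - Phi (x i.-1)| <= 'I(x i.-1, x i, fun t => `|phi t|).
Proof.
move=> iN yi; have /andP[i1 iN'] := iN; have xi := mesh_lt hx iN.
have P := weak_deriv_sub (mesh_a hx (leq_trans (leq_pred _) iN')) (mesh_b hx iN') Phi_wd.
by apply: (weak_deriv_bound P yi); rewrite lexx ltW.
Qed.

(** Cauchy-Schwarz on a single element yields a factor [h i] for both v' and v, hence an oscillation
    of order sqrt h. *)
Let osc_bound i : (1 <= i <= N)%N ->
  'I(x i.-1, x i, fun t => `|phi t|) ^+ 2 <=
  2 * L ^+ 2 * meshsize N x * (1 + (b - a) ^+ 2) * S.
Proof.
move=> iN; have /andP[i1 iN'] := iN; have xi := mesh_lt hx iN.
have [[V V' V2 V'2] _] := norm_P_sub hx Hv.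
have xa := mesh_a hx (leq_trans (leq_pred _) iN'); have xb := mesh_b hx iN'.
have [_ P] := phi_itg L_ge0 hbeta hgamma xa xb V V'.
have P0 : 0 <= 'I(x i.-1, x i, fun t => `|phi t|) by exact: int_ge0.
move: P P0; rewrite -/phi; set O := 'I(x i.-1, x i, fun t => `|phi t|).
set X := 'I(x i.-1, x i, fun t => `|derive1 v t|).
set Y := 'I(x i.-1, x i, fun t => `|v t|) => P O0.
have X0 : 0 <= X by exact: int_ge0.
have Y0 : 0 <= Y by exact: int_ge0.
have h0 := hstep_gt0 hx iN; have hm := hstep_le x iN.
have hl : h i <= b - a by rewrite /hstep; lra.
have X2 : X ^+ 2 <= h i * S.
  apply: le_trans (int_sq xi (itg_sub xa xb V') (itg_sub xa xb V'2)) _.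
  rewrite ler_wpM2l ?(ltW h0)//; apply: int_sub_ge0 => //; first exact: ltW.
  by move=> y _; exact: sqr_ge0.
have Y2 : Y ^+ 2 <= h i * ((b - a) * ((b - a) * S)).
  apply: le_trans (int_sq xi (itg_sub xa xb V) (itg_sub xa xb V2)) _.
  rewrite ler_wpM2l ?(ltW h0)//.
  apply: (@le_trans _ _ 'I(x i.-1, x i, fun=> (b - a) * S)).
    apply: int_le; [exact: itg_sub V2|exact: itg_cst|move=> y /andP[y1 y2]].
    by apply: v_bound; rewrite (le_trans xa)//= (le_trans y2).
  by rewrite (int_cst _ (ltW xi)) mulrC ler_wpM2r ?bS_ge0.
have O2 : O ^+ 2 <= L ^+ 2 * (X + Y) ^+ 2.
  by rewrite -exprMn ler_sqr ?nnegrE ?mulr_ge0 ?addr_ge0.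
have XY : (X + Y) ^+ 2 <= 2 * (h i * ((1 + (b - a) ^+ 2) * S)).
  have := sqr_ge0 (X - Y); lra.
have Q : h i * ((1 + (b - a) ^+ 2) * S) <= meshsize N x * ((1 + (b - a) ^+ 2) * S).
  by rewrite ler_wpM2r// mulr_ge0 ?S_ge0// addr_ge0// sqr_ge0.
apply: le_trans O2 _; have := ler_wpM2l (sqr_ge0 L) (le_trans XY (ler_wpM2l (ler0n _ 2) Q)).
lra.
Qed.

(** With [Phi] frozen at the left node of an element, the quadrature sum and the integral agree
    exactly. Each then differs from its true value by at most [O] times a discrete or continuous L1
    norm of v'. *)
Let quadrature_error (O : R) :
  (forall i, (1 <= i <= N)%N -> 'I(x i.-1, x i, fun t => `|phi t|) <= O) ->
  \sum_(1 <= i < N.+1) \sum_(1 <= j < r.+1) c i j * Phi (g i j)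
  <= 'I(a, b, fun t => derive1 v t * Phi t)
     + O * (T + 'I(a, b, fun t => `|derive1 v t|)).
Proof.
move=> HO; have V := trial_weak_deriv Tv; have cP := weak_deriv_continuous (ltW ab) Phi_wd.
have i1 : itg a b (fun t => Phi t * derive1 v t) by exact: itg_mul_continuous cP V.1.
have i2 := itg_norm V.1.
rewrite (int_eq (g := fun t => Phi t * derive1 v t)) => [|y _]; last by rewrite mulrC.
rewrite (mesh_split hx i1) (mesh_split hx i2) /T -big_split mulr_sumr -big_split.
apply: ler_sum_nat => i; rewrite ltnS => iN; have /andP[_ iN'] := iN.
have xi := mesh_lt hx iN; have [E1 _ _] := trial_elt iN.
have xa := mesh_a hx (leq_trans (leq_pred _) iN'); have xb := mesh_b hx iN'.
have iv := itg_sub xa xb V.1; have ip := itg_sub xa xb i1.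
have HOi := HO i iN.
have h1 : \sum_(1 <= j < r.+1) c i j * (Phi (g i j) - Phi (x i.-1)) <=
    O * \sum_(1 <= j < r.+1) `|c i j|.
  rewrite mulr_sumr; apply: ler_sum_nat => j; rewrite ltnS => jr.
  have /andP[/ltW g1 /ltW g2] := gpt_itv hG hx iN jr.
  rewrite (le_trans (ler_norm _))// normrM mulrC ler_wpM2r//.
  by apply: le_trans HOi; apply: osc; rewrite ?g1.
have h2 : 'I(x i.-1, x i, fun t => Phi (x i.-1) * derive1 v t - Phi t * derive1 v t) <=
    O * 'I(x i.-1, x i, fun t => `|derive1 v t|).
  rewrite -intZ; last exact: itg_norm.
  apply: int_le; [apply: itgB => //; exact: itgZ|apply: itgZ; exact: itg_norm|].
  move=> y yi; rewrite -mulrBl (le_trans (ler_norm _))// normrM ler_wpM2r//.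
  by apply: le_trans HOi; rewrite distrC; exact: osc.
rewrite intB// in h2; last exact: itgZ.
rewrite intZ// E1 in h2.
have h3 : \sum_(1 <= j < r.+1) c i j * (Phi (g i j) - Phi (x i.-1)) =
    \sum_(1 <= j < r.+1) c i j * Phi (g i j) - Phi (x i.-1) * \sum_(1 <= j < r.+1) c i j.
  by rewrite mulr_sumr -sumrB; apply: eq_bigr => j _; ring.
rewrite h3 in h1; move: h1 h2 => /=; lra.
Qed.

Lemma dual_coercive :
  32 * L ^+ 2 * (b - a) * (1 + (b - a) ^+ 2) * meshsize N x <= alpha0 ^+ 2 ->
  alpha0 / 2 * S <= a_P r N x G alpha beta gamma v dual_test.
Proof.
move=> hm; rewrite (a_PE hr hG hx) -/phi//.
have m0 : 0 <= meshsize N x.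
  have N1 : (1 <= 1 <= N)%N by rewrite (mesh_N_gt0 hx).
  exact: le_trans (ltW (hstep_gt0 hx N1)) (hstep_le x N1).
have l0 : 0 < b - a by rewrite subr_gt0.
pose O := Num.sqrt (2 * L ^+ 2 * meshsize N x * (1 + (b - a) ^+ 2) * S).
have O2 : O ^+ 2 = 2 * L ^+ 2 * meshsize N x * (1 + (b - a) ^+ 2) * S.
  by rewrite sqr_sqrtr// !mulr_ge0 ?sqr_ge0 ?S_ge0// addr_ge0// sqr_ge0.
have O0 : 0 <= O by exact: sqrtr_ge0.
have HO i : (1 <= i <= N)%N -> 'I(x i.-1, x i, fun t => `|phi t|) <= O.
  move=> iN; have := osc_bound iN; rewrite -O2 ler_sqr ?nnegrE//.
  exact: int_ge0.
have Q := quadrature_error HO.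
(* After squaring, the left side is at most [O ^+ 2] times [4 * (b - a) * S] and the right side is a
   quarter of [(alpha0 * S) ^+ 2]; with the 2 in [O ^+ 2] this gives the 32 of the mesh
   condition. *)
have E : O * (T + 'I(a, b, fun t => `|derive1 v t|)) <= alpha0 / 2 * S.
  have T0 : 0 <= T by rewrite /T; do 2 apply: sumr_ge0 => ? _.
  have := int_dv; have := sum_abs_c.
  have : 0 <= 'I(a, b, fun t => `|derive1 v t|) by exact: int_ge0.
  move: 'I(a, b, fun t => `|derive1 v t|) T T0 => X Y Y0 X0 Y2 X2.
  rewrite -ler_sqr ?nnegrE ?mulr_ge0 ?addr_ge0 ?S_ge0 ?divr_ge0 ?(ltW alpha0_gt0)//.
  have XY : (Y + X) ^+ 2 <= 4 * ((b - a) * S) by have := sqr_ge0 (X - Y); lra.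
  have h1 : O ^+ 2 * (Y + X) ^+ 2 <= O ^+ 2 * (4 * ((b - a) * S)).
    by rewrite ler_wpM2l ?sqr_ge0.
  have h2 := ler_wpM2r (sqr_ge0 S) hm.
  rewrite exprMn; apply: le_trans h1 _; rewrite O2; lra.
have F : \sum_(1 <= i < N.+1) \sum_(1 <= j < r.+1)
    jump r N dual_test i j * (alpha (g i j) * derive1 v (g i j) - Phi (g i j)) >=
    alpha0 * S - \sum_(1 <= i < N.+1) \sum_(1 <= j < r.+1) c i j * Phi (g i j).
  rewrite -sum_D2 mulr_sumr -sumrB; apply: ler_sum_nat => i; rewrite ltnS => iN.
  rewrite mulr_sumr -sumrB; apply: ler_sum_nat => j; rewrite ltnS => jr.
  rewrite jump_dual// mulrBr lerD2r /c /D.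
  have /andP[/ltW ag /ltW gb] := gpt_ab hG hx iN jr.
  have [_ /(_ (g i j)) + _] := hc; rewrite ag gb => /(_ isT)/andP[a1 _].
  have hA : 0 <= h i * A j * derive1 v (g i j) ^+ 2.
    by rewrite mulr_ge0 ?sqr_ge0// mulr_ge0 ?A_ge0// ltW// (hstep_gt0 hx).
  have := ler_wpM2r hA a1; lra.
apply: le_trans F; have := energy; lra.
Qed.

End Coercive.
End InfSup.

End InfSupCondition.

(** * Linearity of the form and the error estimate *)

Section FiniteVolumeError.
Context {R : realType}.
Local Notation mu := (@lebesgue_measure R).
Local Notation itg c d f := (mu.-integrable `[c, d] (EFin \o f)).
Local Notation "''I' ( c , d , f )" := (\int[mu]_(t in `[c, d]) f t).
Variables (r N : nat) (x G : nat -> R) (a b : R).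
Hypotheses (hr : (1 <= r)%N) (hG : gauss_points r G) (hx : mesh N x a b).
Variables (alpha beta gamma : R -> R) (L : R).
Hypotheses (L0 : 0 <= L) (hbeta : ess_bounded a b L beta) (hgamma : ess_bounded a b L gamma).
Local Notation phi v := (fun t => beta t * derive1 v t + gamma t * v t).
Local Notation aP := (a_P r N x G alpha beta gamma).

Lemma derive1B (u v : R -> R) y : derivable u y 1 -> derivable v y 1 ->
  derive1 (u \- v) y = derive1 u y - derive1 v y.
Proof. by move=> Du Dv; rewrite !derive1E; exact: deriveB. Qed.

Lemma phi_itg_H2 v : H2_broken N x v -> itg a b (phi v).
Proof.
move=> Hv; have [[V V' _ _] _] := norm_P_sub hx Hv.
by have [] := phi_itg L0 hbeta hgamma (lexx a) (lexx b) V V'.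
Qed.

Lemma mesh_int_eq0 F y : itg a b F -> a <= y <= b ->
  (forall i z, (1 <= i <= N)%N -> x i.-1 < z < x i -> F z = 0) -> 'I(a, y, F) = 0.
Proof.
move=> iF /andP[ay yb] F0; apply/eqP; rewrite -normr_le0.
have iF' := itg_sub (lexx a) yb iF.
apply: le_trans (int_abs iF') _.
apply: (@le_trans _ _ 'I(a, b, fun t => `|F t|)).
  by apply: int_sub_ge0 => //; exact: itg_norm.
rewrite (mesh_split hx (itg_norm iF)) big_nat big1// => i; rewrite ltnS => iN.
have xi := ltW (mesh_lt hx iN).
rewrite -(int_oo (f := fun=> 0)) ?int_cst ?mul0r//; last exact: itg_cst.
by move=> z zi; rewrite (F0 i)// normr0.
Qed.

(** [derive1] is additive only where both functions are differentiable, which can fail at the nodes.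
    Gauss points are interior to elements, and the integrals do not see the nodes. *)
Lemma a_PB u v w : H2_broken N x u -> H2_broken N x v ->
  aP (u \- v) w = aP u w - aP v w.
Proof.
move=> Hu Hv; have Huv := H2_brokenB Hu Hv.
have iu := phi_itg_H2 Hu; have iv := phi_itg_H2 Hv; have iuv := phi_itg_H2 Huv.
rewrite !(a_PE hr hG hx)// -sumrB; apply: eq_big_nat => i; rewrite ltnS => iN.
rewrite -sumrB; apply: eq_big_nat => j; rewrite ltnS => jr.
have Du := H2_broken_derivable hG hx Hu iN jr.
have Dv := H2_broken_derivable hG hx Hv iN jr.
rewrite (derive1B Du Dv).
have /andP[/ltW ag /ltW gb] := gpt_ab hG hx iN jr.
have := @mesh_int_eq0 (fun t => (phi u t - phi v t) - phi (u \- v) t) (gpt r x G i j).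
rewrite intB; last 2 first.
- by apply: itgB; [exact: itg_sub iu|exact: itg_sub iv].
- exact: itg_sub iuv.
rewrite intB; [|exact: itg_sub iu|exact: itg_sub iv].
rewrite ag gb => H.
have {H} : 'I(a, gpt r x G i j, phi u) - 'I(a, gpt r x G i j, phi v) -
           'I(a, gpt r x G i j, phi (u \- v)) = 0.
  apply: H => // [|m z mN zm]; first by apply: itgB => //; exact: itgB.
  have xm := mesh_lt hx mN.
  have [k [k' [U K _]]] := H2_broken_data Hu mN.
  have [l [l' [V K' _]]] := H2_broken_data Hv mN.
  have [D1 _] := weak_deriv_derive1 xm U (weak_deriv_continuous (ltW xm) K) zm.
  have [D2 _] := weak_deriv_derive1 xm V (weak_deriv_continuous (ltW xm) K') zm.
  by rewrite (derive1B D1 D2) /=; ring.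
move: 'I(a, _, phi u) 'I(a, _, phi v) 'I(a, _, phi (u \- v)) => p q s pqs.
have -> : s = p - q by lra.
ring.
Qed.

End FiniteVolumeError.

Theorem theorem3p3 (R : realType) (r : nat) (G : nat -> R)
    (a b alpha0 kappa : R)
    (hr : (1 <= r)%N) (hG : gauss_points r G)
    (hab : a < b) (halpha0 : 0 < alpha0) (hkappa : 0 < kappa) :
  exists2 c2 : R, 0 < c2 &
  forall L : R,
  exists M h0 : R, [/\ 0 < M, 0 < h0 &
    forall (alpha beta gamma : R -> R),
    coefficients a b alpha beta gamma alpha0 kappa L ->
    forall (N : nat) (x : nat -> R), mesh N x a b ->
    [/\ forall f u : R -> R,
          (@lebesgue_measure R).-integrable `[a, b] (EFin \o f) ->
          bvp_solution a b alpha beta gamma f u ->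
          (forall i j, (1 <= i <= N)%N -> (1 <= j <= r)%N ->
             derivable u (gpt r x G i j) 1) ->
          forall w : nat -> nat -> R,
          a_P r N x G alpha beta gamma u w = load r N x G f w,
        forall (v : R -> R) (w : nat -> nat -> R),
          H10 a b v -> H2_broken N x v ->
          `|a_P r N x G alpha beta gamma v w| <=
            M * norm_P N x v * norm_P' r N x w
      & meshsize N x <= h0 ->
        (c2%:E <= inf_sup r N x G alpha beta gamma)%E /\
        forall f u uP : R -> R,
          (@lebesgue_measure R).-integrable `[a, b] (EFin \o f) ->
          bvp_solution a b alpha beta gamma f u ->
          H2_broken N x u ->
          fv_solution r N x G alpha beta gamma f uP ->
          norm_P N x (u \- uP) <=
            M / c2 * inf [set norm_P N x (u \- v)
                           | v in [set v | trial_space r N x v]] ]].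
Proof.
have [A [K [A0 A1 Aint Asqr [K0 Kinv]]]] := gauss_rule hr hG.
set l := b - a; have l0 : 0 < l by rewrite subr_gt0.
pose C1 := l ^+ 2 + 1 + K; pose C2 := 1 + r%:R * l ^+ 2.
have C10 : 0 < C1 by rewrite /C1; have := sqr_ge0 l; lra.
have C20 : 0 < C2 by rewrite /C2 ltr_pwDl// mulr_ge0 ?sqr_ge0.
have s10 : 0 < Num.sqrt C1 by rewrite sqrtr_gt0.
have s20 : 0 < Num.sqrt C2 by rewrite sqrtr_gt0.
pose c2 := alpha0 / 2 / (Num.sqrt C1 * Num.sqrt C2).
have c20 : 0 < c2 by rewrite !divr_gt0// mulr_gt0.
(* [c2] is fixed before [L], hence uniform in the size of the coefficients; only [M] and the mesh
   threshold see [L]. *)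
exists c2 => // L.
(* No coefficient is given yet, so the sign of [L] is unknown: the modulus and the added 1 in [H]
   provide the signs needed. The threshold [alpha0 ^+ 2 / H] enforces the mesh condition of
   [dual_coercive]. *)
pose M0 := `|L| * Num.sqrt (4 * r%:R * (1 + l ^+ 2)).
pose H := 32 * (L ^+ 2 + 1) * l * (1 + l ^+ 2).
have M00 : 0 <= M0 by rewrite mulr_ge0 ?sqrtr_ge0.
have H0 : 0 < H.
  have L20 := sqr_ge0 L; have l20 := sqr_ge0 l.
  by rewrite !mulr_gt0//; lra.
exists (M0 + c2), (alpha0 ^+ 2 / H); split.
- by rewrite ltr_wpDl.
- by rewrite divr_gt0// exprn_gt0.
move=> alpha beta gamma hc N x hx.
have [[_ hbeta hgamma] halpha _] := hc.
have L0 : 0 < L.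
  have := halpha a; rewrite lexx (ltW hab) => /(_ isT)/andP[h1 h2].
  exact: lt_le_trans (lt_le_trans halpha0 h1) h2.
have M0E : M0 = L * Num.sqrt (4 * r%:R * (1 + l ^+ 2)) by rewrite /M0 gtr0_norm.
have alphaL y : a <= y <= b -> `|alpha y| <= L.
  move=> /halpha/andP[h1 h2]; rewrite ger0_norm//.
  exact: le_trans (ltW halpha0) h1.
have bounded v w : H2_broken N x v -> `|a_P r N x G alpha beta gamma v w| <=
    M0 * norm_P N x v * norm_P' r N x w.
  by move=> Hv; rewrite M0E; exact: (a_P_bounded hr hG hx (ltW L0) hbeta hgamma w alphaL Hv).
split.
- by move=> f u F U Du w; exact: (variational_exactness hr hG hx).
- move=> v w _ Hv; apply: le_trans (bounded v w Hv) _.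
  rewrite ler_wpM2r ?sqrtr_ge0// ler_wpM2r ?sqrtr_ge0//.
  by rewrite lerDl ltW.
move=> hm.
have key v : trial_space r N x v -> norm_P N x v != 0 ->
    exists2 w, norm_P' r N x w != 0 &
      c2 * (norm_P N x v * norm_P' r N x w) <= a_P r N x G alpha beta gamma v w.
  move=> Tv v0; pose w := dual_test r x G A v.
  have n1 := trial_norm_P hG hx Aint Asqr Kinv Tv.
  have n2 := dual_norm_P' hG hx A0 A1 Aint Asqr Kinv Tv.
  have hm' : 32 * L ^+ 2 * (b - a) * (1 + (b - a) ^+ 2) * meshsize N x <= alpha0 ^+ 2.
    have hm2 : H * meshsize N x <= alpha0 ^+ 2 by rewrite mulrC -ler_pdivlMr.
    apply: le_trans hm2; rewrite -/l /H ler_wpM2r//.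
      have N1 : (1 <= 1 <= N)%N by rewrite (mesh_N_gt0 hx).
      exact: le_trans (ltW (hstep_gt0 hx N1)) (hstep_le x N1).
    rewrite ler_wpM2r ?addr_ge0 ?sqr_ge0// ler_wpM2r ?(ltW l0)// ler_wpM2l// lerDl//.
  have n3 := dual_coercive hr hG hx A0 A1 Aint Asqr Kinv Tv halpha0 hkappa hc hm'.
  move: n1 n2 n3; rewrite -/l -/C1 -/C2 -/w.
  set S := Rintegral _ _ _ => n1 n2 n3.
  have v1 : 0 < norm_P N x v by rewrite lt_neqAle eq_sym v0 norm_P_ge0.
  have S0 : 0 < S.
    by rewrite -(pmulr_rgt0 _ C10); apply: lt_le_trans n1; rewrite exprn_gt0.
  (* If the norm of [w] were zero, boundedness would make the form vanish, against coercivity with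
     [S > 0]. *)
  have w0 : norm_P' r N x w != 0.
    apply/eqP => w0; have := bounded v w (trial_space_H2_broken hx Tv).
    rewrite w0 mulr0 normr_le0 => /eqP a0; move: n3; rewrite a0.
    by apply/negP; rewrite -ltNge mulr_gt0// divr_gt0.
  exists w => //; apply: le_trans n3.
  have -> : alpha0 / 2 * S = c2 * (Num.sqrt C1 * Num.sqrt C2 * S).
    by rewrite /c2; field; rewrite !gt_eqF.
  rewrite ler_wpM2l ?(ltW c20)//.
  have -> : Num.sqrt C1 * Num.sqrt C2 * S = Num.sqrt (C1 * S) * Num.sqrt (C2 * S).
    by rewrite !sqrtrM ?(ltW C10) ?(ltW C20)// mulrACA -[Num.sqrt S * _]expr2 sqr_sqrtr// ltW.
  apply: ler_pM; rewrite ?norm_P_ge0 ?norm_P'_ge0//.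
    by rewrite -[leLHS]ger0_norm ?norm_P_ge0// -sqrtr_sqr ler_wsqrtr.
  by rewrite -[leLHS]ger0_norm ?norm_P'_ge0// -sqrtr_sqr ler_wsqrtr.
split.
  apply/ereal_infP => _ [v [Tv v0] <-]; have [w w0 hw] := key v Tv v0.
  apply: le_ereal_sup_tmp; exists
    (a_P r N x G alpha beta gamma v w / (norm_P N x v * norm_P' r N x w))%:E.
    by exists w.
  rewrite lee_fin ler_pdivlMr// mulr_gt0// lt_neqAle eq_sym.
    by rewrite v0 norm_P_ge0.
  by rewrite w0 norm_P'_ge0.
move=> f u uP F U Hu [TuP fvP].
have ratio0 : 0 < (M0 + c2) / c2 by apply: divr_gt0 => //; exact: ltr_wpDl.
(* Dividing by the constant turns the claim into a lower bound for every member of the set, which is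
   nonempty since [uP] is itself a trial function. *)
rewrite mulrC -(ler_pdivrMr _ _ ratio0).
apply: lb_le_inf.
  by exists (norm_P N x (u \- uP)); exists uP.
move=> _ [v Tv <-].
have Hv := trial_space_H2_broken hx Tv; have HuP := trial_space_H2_broken hx TuP.
have Huv := H2_brokenB Hu Hv; have Hvp := H2_brokenB Hv HuP.
have tri : norm_P N x (u \- uP) <= norm_P N x (u \- v) + norm_P N x (v \- uP).
  rewrite (_ : u \- uP = (u \- v) \+ (v \- uP)); last first.
    by apply/funext => t /=; ring.
  exact: (norm_PD hx).
(* Galerkin orthogonality: [u] and [uP] have the same load, so [v \- uP] and [u \- v] have opposite
   values of the form. The inf-sup bound applies to the first and boundedness to the second. *)
have e_le : c2 * norm_P N x (v \- uP) <= M0 * norm_P N x (u \- v).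
  have [->|e0] := eqVneq (norm_P N x (v \- uP)) 0.
    by rewrite mulr0 mulr_ge0 ?norm_P_ge0.
  have [w w0 hw] := key _ (trialB Tv TuP) e0.
  have w1 : 0 < norm_P' r N x w by rewrite lt_neqAle eq_sym w0 norm_P'_ge0.
  have B := a_PB hr hG hx alpha (ltW L0) hbeta hgamma.
  have exact_u : a_P r N x G alpha beta gamma u w = load r N x G f w.
    apply: (variational_exactness hr hG hx) => // i j iN jr.
    exact: (H2_broken_derivable hG hx).
  have aE : a_P r N x G alpha beta gamma (v \- uP) w =
      - a_P r N x G alpha beta gamma (u \- v) w.
    by rewrite (B v uP w Hv HuP) (B u v w Hu Hv) fvP exact_u opprB.
  have le_w : a_P r N x G alpha beta gamma (v \- uP) w <=
      M0 * norm_P N x (u \- v) * norm_P' r N x w.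
    by apply: le_trans (bounded _ w Huv); rewrite aE -normrN; exact: ler_norm.
  move: (le_trans hw le_w) w1.
  move: (norm_P N x (v \- uP)) (norm_P N x (u \- v)) (norm_P' r N x w) => n1 n2 n3.
  by rewrite mulrA => le3 n30; rewrite (ler_pM2r n30) in le3.
rewrite (ler_pdivrMr _ _ ratio0).
have -> : norm_P N x (u \- v) * ((M0 + c2) / c2) =
    norm_P N x (u \- v) + M0 * norm_P N x (u \- v) / c2.
  by field; rewrite gt_eqF.
apply: le_trans tri _; rewrite lerD2l ler_pdivlMr// mulrC.
exact: e_le.
Qed.
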